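(* There is an absolute constant $c>0$ such that the following holds. Consider weighted $k$-server on a uniform metric with $d$ distinct weights $w_1<\dots<w_d$, where $k_i\ge 1$ servers have weight $w_i$ and $k=\sum_{i=1}^d k_i$. Then the generalized Work Function Algorithm $\mathrm{WFA}_{1/2}$ (with the distance between configurations defined below) has competitive ratio at most $2^{c\,d\,k^3\prod_{i=1}^d (k_i+1)}$.
   Context: Uniform metric on a finite set $U$ ($d(p,q)=1$ for $p\ne q$). There are $d$ weight classes; class $i$ consists of $k_i$ servers of weight $w_i$, and moving a server of class $i$ to another point costs $w_i$. Requests $\sigma_1,\dots,\sigma_T\in U$ arrive online and at time $t$ some server must be at $\sigma_t$; the goal is to minimize total movement cost. Servers in a class are treated as indistinguishable: a configuration is a map $C$ assigning to each $i\in\{1,\dots,d\}$ a set $C(i)\subseteq U$ with $|C(i)|=k_i$. The distance used by the algorithm is $d(A,B)=\sum_{i=1}^d k_i w_i\mathbf 1_{A(i)\ne B(i)}$, and the work function $\mathrm{WF}_t(C)$ is the minimum, over sequences of configurations $C_1,\dots,C_t$ with $\sigma_s\in\bigcup_i C_s(i)$ for each $s$, of $\sum_{s=1}^t d(C_{s-1},C_s)+d(C_t,C)$, where $C_0$ is the initial configuration. $\mathrm{WFA}_{1/2}$, being in configuration $C_{t-1}$, moves upon request $\sigma_t$ to some $C_t\in\arg\min_C\big(\mathrm{WF}_t(C)+\tfrac12 d(C,C_{t-1})\big)$. An online algorithm is $\rho$-competitive if there is a constant $\alpha$ independent of the request sequence such that its true movement cost is at most $\rho\cdot\mathrm{OPT}+\alpha$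 on every request sequence, $\mathrm{OPT}$ being the optimal offline movement cost from the same initial configuration. *)

(* Defs.v *)
From HB Require Import structures.
From mathcomp Require Import all_boot all_order all_algebra.
From mathcomp Require Import all_classical all_reals all_analysis.

Set Implicit Arguments.
Unset Strict Implicit.
Unset Printing Implicit Defensive.

Import Order.TTheory GRing.Theory Num.Theory.

Local Open Scope classical_set_scope.
Local Open Scope ring_scope.

Section WeightedServer.
Variables (R : realType) (U : finType) (d : nat).
Variables (k : 'I_d -> nat) (w : 'I_d -> R).

Definition config : Type :=
  {C : {ffun 'I_d -> {set U}} | [forall i, #|C i| == k i]}.

Definition servers (C : config) (i : 'I_d) : {set U} := val C i.

Definition serves (x : U) (C : config) : bool :=
  x \in (\bigcup_i servers C i)%SET.

(* True movement cost: servers of one class are interchangeable, so in passing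
   from A to B exactly #|B(i) \ A(i)| servers of class i change position. *)
Definition move_cost (A B : config) : R :=
  \sum_i w i * #|servers B i :\: servers A i|%:R.

Definition conf_dist (A B : config) : R :=
  \sum_i (k i)%:R * w i * (servers A i != servers B i)%:R.

Fixpoint path_cost (dist : config -> config -> R) (C : config)
    (cs : seq config) : R :=
  if cs is C' :: cs' then dist C C' + path_cost dist C' cs' else 0.

(* [all2] also forces the schedule to have one configuration per request. *)
Definition schedules (sigma : seq U) : set (seq config) :=
  [set cs | all2 serves sigma cs].

(* [schedules sigma] is finite, and nonempty as soon as there is a configuration
   and some k i is positive, so both infima below are minima. *)
Definition work_fun (C0 : config) (sigma : seq U) (C : config) : R :=
  inf [set path_cost conf_dist C0 cs + conf_dist (last C0 cs) C
      | cs in schedules sigma].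

Definition opt_cost (C0 : config) (sigma : seq U) : R :=
  inf [set path_cost move_cost C0 cs | cs in schedules sigma].

(* A deterministic online algorithm maps the requests seen so far to its current
   configuration. *)
Definition online_alg : Type := seq U -> config.

Definition trajectory (A : online_alg) (sigma : seq U) : seq config :=
  [seq A (take t.+1 sigma) | t <- iota 0 (size sigma)].

Definition alg_cost (A : online_alg) (sigma : seq U) : R :=
  path_cost move_cost (A [::]) (trajectory A sigma).

(* Ties in the argmin may be broken arbitrarily, even depending on the whole
   history. *)
Definition is_WFA (lambda : R) (C0 : config) (A : online_alg) : Prop :=
  A [::] = C0 /\
  forall (sigma : seq U) (x : U) (C : config),
    let s := rcons sigma x in
    work_fun C0 s (A s) + lambda * conf_dist (A s) (A sigma)
      <= work_fun C0 s C + lambda * conf_dist C (A sigma).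

(* The first conjunct says that A is a legal algorithm: every request is served
   on arrival. *)
Definition competitive (rho : R) (C0 : config) (A : online_alg) : Prop :=
  (forall sigma : seq U, all2 serves sigma (trajectory A sigma)) /\
  exists alpha : R, forall sigma : seq U,
    alg_cost A sigma <= rho * opt_cost C0 sigma + alpha.

End WeightedServer.

(* Main.v *)
Require Import Defs.
From HB Require Import structures.
From mathcomp Require Import all_boot all_order all_algebra.
From mathcomp Require Import all_classical all_reals all_analysis.
From mathcomp Require Import fintype finset zify ring lra.

Set Implicit Arguments.
Unset Strict Implicit.
Unset Printing Implicit Defensive.

Import Order.TTheory GRing.Theory Num.Theory.

Local Open Scope ring_scope.

(** Write [W_i = k_i w_i] and view a configuration as a tuple of sets.  Freeze
    the classes from [j] on at a tuple [T] of small sets and let the lighter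
    classes move according to a fixed hierarchical pattern of moving times.  The
    tuples [T] that can serve an interval of requests in this way have few
    minimal elements: a Kraft inequality with base [A] survives intersections
    without loss, and forgetting a class with [k_i] servers turns [A] into
    [A ^ (k_i + 1)].  This gives at most [2 ^ (d k prod_(i < j) (k_i + 1))]
    minimal tuples, whatever the length of the interval.  Since finitely many
    patterns have a cheap common refinement, a time interval can be cut into
    boundedly many pieces such that every tuple which was cheap before a piece
    stays cheap during it.

    The potential of WFA is its own work function value [v_t = WF_t(C_t)]: up to a
    telescoping sum, twice the total of the hits [WF_(t+1)(C_t) - WF_t(C_t)]
    bounds its cost.  Within a phase where the minimum of the work function grows
    by at most the diameter, an optimal path to [C_t] is cheap.  Nest the pieces
    more often than such a path can move classes [>= j]: on some gap the path
    keeps these classes at a tuple [B], which then stays cheap, and comparing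
    [C_t] with the configurations containing [B] (here the factor 1/2 in WFA is
    used) shows that the rest of the path costs only a multiple of the total
    weight of the classes [< j].  Iterating down to [j = 0] leaves pieces without
    any hit. *)

(** * Kraft inequality for families of tuples of sets *)

Section Branching.
Variables (R : realType) (U : finType) (d : nat) (k : 'I_d -> nat).

Definition tup := {ffun 'I_d -> {set U}}.

Definition tle (S T : tup) := [forall i, S i \subset T i].

Definition tsz (T : tup) : nat := (\sum_i #|T i|)%N.

(** Sets smaller than [k i] are allowed, so that minimal tuples can be counted; the classes below
    [j] are emptied because they are not frozen. *)
Definition valid (j : nat) (T : tup) :=
  [forall i : 'I_d, if (i < j)%N then T i == set0 else (#|T i| <= k i)%N].

Definition tupd (T : tup) (i0 : 'I_d) (S : {set U}) : tup :=
  [ffun i => if i == i0 then S else T i].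

(* The weight condition is a Kraft inequality; this is what makes the notion
   stable under intersections without any loss in [a]. *)
Definition branching (a : R) (j : nat) (F : tup -> Prop) :=
  forall T, valid j T -> exists L : seq tup,
    [/\ forall T', T' \in L -> [/\ valid j T', tle T T' & F T'],
        forall T', valid j T' -> tle T T' -> F T' ->
          exists2 T'', T'' \in L & tle T'' T'
      & \sum_(T' <- L) a ^+ (tsz T' - tsz T) <= 1].

Definition ksum : nat := (\sum_i k i)%N.

Implicit Types T V : tup.

Lemma tleP (S : tup) T : reflect (forall i, S i \subset T i) (tle S T).
Proof. exact: forallP. Qed.

Lemma tle_refl T : tle T T.
Proof. by apply/tleP. Qed.

Lemma tle_trans (S : tup) T V : tle S T -> tle T V -> tle S V.
Proof.
move=> /tleP h1 /tleP h2; apply/tleP => i; exact: subset_trans (h1 i) (h2 i).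
Qed.

Lemma tsz_le (S : tup) T : tle S T -> (tsz S <= tsz T)%N.
Proof. by move=> /tleP h; apply: leq_sum => i _; apply: subset_leq_card. Qed.

Lemma tle_eq (S : tup) T : tle S T -> (tsz T <= tsz S)%N -> S = T.
Proof.
move=> /tleP h hs; apply/ffunP => i; apply/eqP; rewrite eqEcard h /=.
rewrite leqNgt; apply/negP => hi; move: hs; apply/negP; rewrite -ltnNge.
rewrite /tsz (bigD1 i) //= [X in (_ < X)%N](bigD1 i) //=.
rewrite -addSn; apply: leq_add => //; apply: leq_sum => i' _.
exact: subset_leq_card.
Qed.

Lemma tle_lt (S : tup) T : tle S T -> S <> T -> (tsz S < tsz T)%N.
Proof. by move=> h hn; rewrite ltnNge; apply/negP => /(tle_eq h). Qed.

Lemma valid_le j T i : valid j T -> (#|T i| <= k i)%N.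
Proof.
move=> /forallP /(_ i); case: ifP => // _ /eqP ->; by rewrite cards0.
Qed.

Lemma valid_tsz j T : valid j T -> (tsz T <= ksum)%N.
Proof. by move=> h; apply: leq_sum => i _; apply: valid_le h. Qed.

Lemma branching_ext (a : R) j (F G : tup -> Prop) :
  (forall T, valid j T -> (F T <-> G T)) -> branching a j F -> branching a j G.
Proof.
move=> FG hF T vT; have [L [h1 h2 h3]] := hF T vT; exists L; split=> //.
- by move=> T' /h1 [v t f]; split=> //; apply/FG.
- by move=> T' v t g; apply: h2 => //; apply/FG.
Qed.

Lemma branching_mem (a : R) j (F : tup -> Prop) T :
  valid j T -> F T -> exists L : seq tup,
    [/\ forall T', T' \in L -> [/\ valid j T', tle T T' & F T'],
        forall T', valid j T' -> tle T T' -> F T' ->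
          exists2 T'', T'' \in L & tle T'' T'
      & \sum_(T' <- L) a ^+ (tsz T' - tsz T) <= 1].
Proof.
move=> vT fT; exists [:: T]; split.
- by move=> T'; rewrite inE => /eqP ->; split=> //; apply: tle_refl.
- by move=> T' _ tT _; exists T; rewrite ?inE.
- by rewrite big_seq1 subnn expr0.
Qed.

(** While [T] fails one of the two families, branch with that family and recurse on the strictly
    larger results. Exponents add along a branch, so nested Kraft sums multiply and stay at most
    1. *)
Lemma branchingI (a : R) j (F G : tup -> Prop) : 0 <= a ->
  branching a j F -> branching a j G -> branching a j (fun T => F T /\ G T).
Proof.
move=> a0 hF hG T vT.
have [n] := ubnP (ksum - tsz T); elim: n => // n IH in T vT *; move=> hn.
have [[fT gT]|nFG] := pselect (F T /\ G T).
  by apply: branching_mem.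
have [H [hH nH HFG]] : exists H, [/\ branching a j H, ~ H T
    & forall T', F T' /\ G T' -> H T'].
  have [fT|nF] := pselect (F T).
    by exists G; split=> // [gT|T' []//]; apply: nFG.
  by exists F; split=> // T' [].
have [L [h1 h2 h3]] := hH T vT.
have sub T' : T' \in L -> exists L' : seq tup,
    [/\ forall T'', T'' \in L' -> [/\ valid j T'', tle T' T'' & F T'' /\ G T''],
        forall V, valid j V -> tle T' V -> F V /\ G V ->
          exists2 T'', T'' \in L' & tle T'' V
      & \sum_(V <- L') a ^+ (tsz V - tsz T') <= 1].
  move=> T'L; have [v' t' H'] := h1 _ T'L.
  have lt : (tsz T < tsz T')%N by apply: tle_lt => // E; apply: nH; rewrite E.
  have := valid_tsz v'; move=> ks; apply: IH => //; lia.
have /choice [f fP] : forall T', exists L' : seq tup, T' \in L ->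
    [/\ forall T'', T'' \in L' -> [/\ valid j T'', tle T' T'' & F T'' /\ G T''],
        forall V, valid j V -> tle T' V -> F V /\ G V ->
          exists2 T'', T'' \in L' & tle T'' V
      & \sum_(V <- L') a ^+ (tsz V - tsz T') <= 1].
  move=> T'; have [T'L|_] := boolP (T' \in L); last by exists [::].
  by have [L' ?] := sub _ T'L; exists L'.
exists (flatten [seq f T' | T' <- L]); split.
- move=> V /flatten_mapP [T' T'L VT']; have [g1 _ _] := fP _ T'L.
  have [v1 t1 FG1] := g1 _ VT'; split=> //.
  by have [_ t2 _] := h1 _ T'L; apply: tle_trans t1.
- move=> V vV tV FGV; have [T' T'L tT'] := h2 V vV tV (HFG _ FGV).
  have [_ g2 _] := fP _ T'L; have [T'' T''L tT''] := g2 V vV tT' FGV.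
  by exists T'' => //; apply/flatten_mapP; exists T'.
- apply: le_trans h3; rewrite big_flatten big_map /=.
  rewrite big_seq [X in _ <= X]big_seq; apply: ler_sum => T' T'L.
  have [g1 _ g3] := fP _ T'L; have [_ t2 _] := h1 _ T'L.
  rewrite -[X in _ <= X]mulr1.
  apply: le_trans (ler_wpM2l (exprn_ge0 _ a0) g3).
  rewrite mulr_sumr big_seq [X in _ <= X]big_seq; apply: ler_sum => V VL.
  have [_ t3 _] := g1 _ VL; rewrite -exprD.
  by rewrite addnC addnBA ?tsz_le // subnK // tsz_le.
Qed.

Lemma tupd_valid j (i0 : 'I_d) T (S : {set U}) : i0 = j :> nat -> valid j.+1 T ->
  (#|S| <= k i0)%N -> valid j (tupd T i0 S).
Proof.
move=> ij /forallP vT hS; apply/forallP => i; rewrite ffunE.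
case: (eqVneq i i0) => [->|ne]; first by rewrite -ij ltnn.
have := vT i; case: (ltngtP i j) => [lt|lt|eq].
- by rewrite (leq_trans lt).
- by rewrite ltnS leqNgt lt.
- by case/eqP: ne; apply: val_inj; rewrite /= eq.
Qed.

Lemma valid_weak j T : valid j.+1 T -> valid j T.
Proof.
move=> /forallP vT; apply/forallP => i; have := vT i.
case: (ltnP i j.+1) => h; case: (ltnP i j) => h2 //.
- by move/eqP => ->; rewrite cards0.
- lia.
Qed.

Lemma tsz_tupd T (i0 : 'I_d) (S : {set U}) :
  (tsz T + #|S| = tsz (tupd T i0 S) + #|T i0|)%N.
Proof.
rewrite /tsz (bigD1 i0) //= [in RHS](bigD1 i0) //= ffunE eqxx.
have -> : (\sum_(i | i != i0) #|tupd T i0 S i| = \sum_(i | i != i0) #|T i|)%N.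
  by apply: eq_bigr => i /negPf ne; rewrite ffunE ne.
by rewrite addnC addnA addnAC.
Qed.

(** Emptying class [i0] in the minimal tuples for [F] loses at most [k i0] in size. As [T] is
    outside the projected family, a growth m >= 1 remains, so the old growth is at most m + k <= m
    (k + 1), which the new base absorbs. *)
Lemma branching_proj (a : R) j (i0 : 'I_d) (F : tup -> Prop) :
  i0 = j :> nat -> 0 < a -> a <= 1 -> branching a j F ->
  branching (a ^+ (k i0).+1) j.+1
    (fun T => exists2 S : {set U}, (#|S| <= k i0)%N & F (tupd T i0 S)).
Proof.
move=> ij a0 a1 hF T vT.
set G := fun T => exists2 S : {set U}, (#|S| <= k i0)%N & F (tupd T i0 S).
have [gT|nG] := pselect (G T); first by apply: branching_mem.
have [L [h1 h2 h3]] := hF T (valid_weak vT).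
have updT' T' : T' \in L -> [/\ valid j.+1 (tupd T' i0 set0),
    tle T (tupd T' i0 set0) & G (tupd T' i0 set0)].
  move=> T'L; have [v' t' f'] := h1 _ T'L; split.
  - apply/forallP => i; rewrite ffunE; have /forallP /(_ i) := v'.
    case: (eqVneq i i0) => [->|ne]; first by rewrite ij ltnSn eqxx.
    case: (ltngtP i j) => [lt|lt|eq].
    + by have -> : (i < j.+1)%N by lia.
    + by have -> : (i < j.+1)%N = false by lia.
    + by case/eqP: ne; apply: val_inj; rewrite /= eq.
  - apply/tleP => i; rewrite ffunE; case: eqP => [->|_]; last exact/tleP.
    have /forallP /(_ i0) := vT; rewrite ij ltnSn => /eqP ->.
    by rewrite subxx.
  - exists (T' i0); first exact: valid_le v'.
    congr F : f'; apply/ffunP => i; rewrite !ffunE; by case: eqP => [->|].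
exists [seq tupd T' i0 set0 | T' <- L]; split.
- by move=> V /mapP [T' T'L ->]; apply: updT'.
- move=> V vV tV [S hS fS]; have tVS : tle V (tupd V i0 S).
    apply/tleP => i; rewrite ffunE; case: eqP => [->|//].
    by have /forallP /(_ i0) := vV; rewrite ij ltnSn => /eqP ->; rewrite sub0set.
  have [T'' T''L tT''] :=
    h2 _ (tupd_valid ij vV hS) (tle_trans tV tVS) fS.
  exists (tupd T'' i0 set0); first exact: map_f.
  apply/tleP => i; rewrite ffunE; case: eqP => [->|ne]; first exact: sub0set.
  by have /tleP /(_ i) := tT''; rewrite ffunE; case: eqP.
- apply: le_trans h3; rewrite big_map big_seq [X in _ <= X]big_seq.
  apply: ler_sum => T' T'L; have [v1 t1 g1] := updT' _ T'L.
  have [v' t' f'] := h1 _ T'L.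
  have lt : (tsz T < tsz (tupd T' i0 set0))%N.
    by apply: tle_lt => // E; apply: nG; rewrite E.
  have := tsz_tupd T' i0 set0; rewrite cards0 => E.
  have := valid_le i0 v' => kk.
  rewrite -exprM; apply: ler_wiXn2l => //; first exact: ltW.
  set m := (tsz (tupd T' i0 set0) - tsz T)%N.
  have m1 : (0 < m)%N by rewrite /m; lia.
  have : (tsz T' - tsz T <= m + k i0)%N by rewrite /m; lia.
  move=> /leq_trans; apply; rewrite mulSn addnC; nia.
Qed.

(** A minimal enlargement of [T] adds [x] to a single class: at most [d] choices, each of weight
    [a]. *)
Lemma branching_leaf (a : R) (x : U) : 0 <= a -> d%:R * a <= 1 ->
  branching a 0 (fun T => exists i, x \in T i).
Proof.
move=> a0 da T vT.
have [fT|nF] := pselect (exists i, x \in T i); first by apply: branching_mem.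
pose g i := tupd T i (x |: T i).
have gle i : tle T (g i).
  by apply/tleP => i'; rewrite ffunE; case: eqP => [->|//]; apply: subsetUr.
exists [seq V <- [seq g i | i <- enum 'I_d] | valid 0 V]; split.
- move=> V; rewrite mem_filter => /andP[vV /mapP[i _ E]]; split=> //.
    by rewrite E.
  by exists i; rewrite E ffunE eqxx setU11.
- move=> V vV tV [i xi]; exists (g i); last first.
    apply/tleP => i'; rewrite ffunE; case: eqP => [->|_]; last exact/tleP.
    by rewrite subUset sub1set xi; apply/tleP.
  rewrite mem_filter map_f ?mem_enum // andbT; apply/forallP => i' /=.
  rewrite (leq_trans _ (valid_le i' vV)) //; apply: subset_leq_card.
  rewrite ffunE; case: eqP => [->|_]; last exact/tleP.
  by rewrite subUset sub1set xi; apply/tleP.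
- apply: le_trans da; rewrite big_filter big_map.
  apply: (@le_trans _ _ (\sum_(i <- enum 'I_d) a)); last first.
    rewrite big_const_seq count_predT size_enum_ord iter_addr addr0.
    by rewrite mulr_natl.
  rewrite [X in X <= _]big_mkcond; apply: ler_sum => i _; case: ifP => // _.
  have := tsz_tupd T i (x |: T i); rewrite cardsU1.
  have -> : x \notin T i by apply/negP => xi; apply: nF; exists i.
  move=> E; have -> : (tsz (g i) - tsz T)%N = 1%N by rewrite /g; lia.
  by rewrite expr1.
Qed.

(** * Tuples that serve an interval under a fixed pattern of moving times *)

Variable rq : nat -> U.

(* Between the steps [v] and [v.+1] exactly the classes below [z v.+1] may be
   moved; the classes from [j] on are frozen at [T]. *)
Definition fam (z : nat -> nat) (j s t : nat) (T : tup) : Prop :=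
  exists2 x : nat -> tup,
    forall u, (s <= u < t)%N ->
      [/\ forall i, (#|x u i| <= k i)%N,
          forall i : 'I_d, (j <= i)%N -> x u i = T i
        & exists i, rq u \in x u i]
  & forall v, (s <= v)%N -> (v.+1 < t)%N ->
      forall i : 'I_d, (z v.+1 <= i)%N -> x v.+1 i = x v i.

Definition kprod (j : nat) : nat := (\prod_(i < d | (i < j)%N) (k i).+1)%N.

Lemma fam_sub z j s t s' t' T : (s <= s')%N -> (t' <= t)%N ->
  fam z j s t T -> fam z j s' t' T.
Proof.
move=> ss tt [x h1 h2]; exists x => [u /andP[u1 u2]|v v1 v2].
  by apply: h1; rewrite (leq_trans ss u1) (leq_trans u2 tt).
by apply: h2; [apply: leq_trans v1|apply: leq_trans tt].
Qed.

Lemma fam_mono z z' j s t T T' : (forall u, (z u <= z' u)%N) ->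
  (forall i : 'I_d, (j <= i)%N -> T i \subset T' i) ->
  valid j T' -> fam z j s t T -> fam z' j s t T'.
Proof.
move=> zz /= tT vT' [x h1 h2].
exists (fun u => [ffun i : 'I_d => if (i < j)%N then x u i else T' i]).
  move=> u hu; have [x1 x2 [i xi]] := h1 u hu; split.
  - by move=> i'; rewrite ffunE; case: ifP => // _; apply: valid_le vT'.
  - by move=> i' ji'; rewrite ffunE ltnNge ji'.
  - exists i; rewrite ffunE; case: ltnP => // ji.
    by apply: (subsetP (tT i ji)); rewrite -x2.
move=> v v1 v2 i zi; rewrite !ffunE; case: ifP => // _.
by apply: h2 => //; apply: leq_trans zi.
Qed.

(** The classes from [j] on are frozen at [T] on both sides and all lighter ones may move at [u.+1],
    so the halves need no compatibility. *)
Lemma fam_split z j s u t T : (s <= u)%N -> (u.+1 < t)%N -> (j <= z u.+1)%N ->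
  fam z j s u.+1 T /\ fam z j u.+1 t T -> fam z j s t T.
Proof.
move=> su ut jz [[x h1 h2] [y g1 g2]].
exists (fun v => if (v <= u)%N then x v else y v).
  move=> v /andP[v1 v2]; case: leqP => vu.
    by apply: h1; rewrite v1.
  by apply: g1; rewrite vu.
move=> v v1 v2 i zi; case: (ltngtP v u) => vu.
- by apply: h2.
- by apply: g2.
- move: zi v2; rewrite vu => zi v2.
  have [|_ x2 _] := h1 u; first by rewrite su ltnSn.
  have [|_ y2 _] := g1 u.+1; first by rewrite ltnSn.
  by rewrite x2 ?y2 // (leq_trans jz).
Qed.

Lemma fam_proj z j s t (i0 : 'I_d) T : i0 = j :> nat -> valid j.+1 T ->
  (forall u, (s <= u)%N -> (u.+1 < t)%N -> (z u.+1 <= j)%N) ->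
  (exists2 S : {set U}, (#|S| <= k i0)%N & fam z j s t (tupd T i0 S)) <->
  fam z j.+1 s t T.
Proof.
move=> ij vT hz; split=> [[S hS [x h1 h2]]|[x h1 h2]].
  exists x => // u hu; have [x1 x2 x3] := h1 u hu; split=> // i ji.
  rewrite x2 ?(ltnW ji) // ffunE; case: eqP => // E.
  by move: ji; rewrite E ij ltnn.
case: (leqP t s) => ts.
  exists set0; rewrite ?cards0 //; exists x; last by move=> v v1 v2; lia.
  by move=> u; lia.
have cst u : (s <= u < t)%N -> x u i0 = x s i0.
  elim: u => [|u IH] /andP[u1 u2]; first by have -> : s = 0%N by lia.
  move: u1; rewrite leq_eqVlt => /orP[/eqP <- //|u1].
  rewrite (h2 u) //; first by apply: IH; lia.
  by rewrite ij; apply: hz.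
exists (x s i0).
  by have [|x1 _ _] := h1 s; first by rewrite leqnn ts.
exists x => // u hu; have [x1 x2 x3] := h1 u hu; split=> // i ji.
rewrite ffunE; case: eqP => [->|ne]; first exact: cst.
apply: x2; rewrite ltn_neqAle ji andbT -ij; apply/eqP => E.
by apply: ne; apply: val_inj.
Qed.

Lemma kprodS j (i0 : 'I_d) : i0 = j :> nat -> kprod j.+1 = (kprod j * (k i0).+1)%N.
Proof.
move=> ij; rewrite /kprod (bigD1 i0) /=; last by rewrite ij.
rewrite mulnC; congr (_ * _)%N; apply: eq_bigl => i.
rewrite ltnS andbC; apply/andP/idP => [[ne le]|lt].
  rewrite ltn_neqAle le andbT; apply/eqP => E; move/eqP: ne; apply.
  by apply: val_inj; rewrite /= E.
by split; [apply/eqP => E; move: lt; rewrite E ij ltnn|apply: ltnW].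
Qed.

Lemma kprod0 : kprod 0 = 1%N.
Proof. by rewrite /kprod big_pred0. Qed.

Lemma kprod_gt0 j : (0 < kprod j)%N.
Proof. by apply: prodn_gt0. Qed.

(** Induction on the level, then on the length. A time at which class [j] may move splits the
    interval into independent halves, an intersection; without such a time class [j] is constant and
    is projected away, which multiplies the exponent by [(k i0).+1]. At level 0 every request is a
    separate condition. *)
Lemma fam_branching (a : R) z j s t : 0 < a -> a <= 1 -> d%:R * a <= 1 ->
  (j <= d)%N -> branching (a ^+ kprod j) j (fam z j s t).
Proof.
move=> a0 a1 da; elim: j s t => [|j IHj] s t jd.
  rewrite kprod0 expr1.
  have [n] := ubnP (t - s); elim: n => // n IH in s t *; move=> hn.
  case: (leqP t s) => ts.
    move=> T vT; apply: branching_mem => //.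
    by exists (fun=> T) => [u|v]; lia.
  case: (leqP t s.+1) => ts1.
    have -> : t = s.+1 by lia.
    apply: branching_ext (branching_leaf (rq s) (ltW a0) da) => T vT; split.
      move=> [i xi]; exists (fun=> T) => // u hu; have -> : u = s by lia.
      by split=> //; [move=> i'; apply: valid_le vT|exists i].
    move=> [x h1 _]; have [|_ x2 [i xi]] := h1 s; first by lia.
    by exists i; rewrite -x2.
  apply: (@branching_ext _ _ (fun T => fam z 0 s s.+1 T /\ fam z 0 s.+1 t T)).
    move=> T vT; split; first by apply: fam_split.
    by move=> fT; split; apply: fam_sub fT; lia.
  by apply: branchingI; [exact: ltW|apply: IH; lia|apply: IH; lia].
pose i0 := Ordinal jd.
have a0' : 0 < a ^+ kprod j by apply: exprn_gt0.
have a1' : a ^+ kprod j <= 1 by apply: exprn_ile1 => //; apply: ltW.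
rewrite (@kprodS j i0) // exprM.
have [n] := ubnP (t - s); elim: n => // n IH in s t *; move=> hn.
have [[u [su ut jz]]|nu] := pselect (exists u,
    [/\ (s <= u)%N, (u.+1 < t)%N & (j < z u.+1)%N]).
  apply: (@branching_ext _ _
     (fun T => fam z j.+1 s u.+1 T /\ fam z j.+1 u.+1 t T)).
    move=> T vT; split; first by apply: fam_split.
    by move=> fT; split; apply: fam_sub fT; lia.
  apply: branchingI; [|apply: IH; lia|apply: IH; lia].
  by apply: exprn_ge0; apply: ltW.
apply: branching_ext
  (@branching_proj _ j i0 _ erefl a0' a1' (IHj s t (ltnW jd))).
move=> T vT; apply: (@fam_proj z j s t i0) => // u su ut.
by rewrite leqNgt; apply/negP => jz; apply: nu; exists u.
Qed.

End Branching.

(** * Cutting an interval of times into pieces *)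

Section Cuts.
Variable R : realType.

(** A cut [c] separates the times [c.-1] and [c], hence the strict inequality on the left only. *)
Definition nocut (L : seq nat) (s e : nat) :=
  all (fun c => ~~ (s < c <= e)%N) L.

Lemma sum_nat_sub (f : nat -> R) s t s' t' : (forall u, 0 <= f u) ->
  (s <= s')%N -> (t' <= t)%N ->
  \sum_(s' <= u < t') f u <= \sum_(s <= u < t) f u.
Proof.
move=> f0 ss tt; case: (leqP t' s') => ts.
  by rewrite big_geq // sumr_ge0.
rewrite (big_cat_nat (m := s) (n := s') (p := t)) //=; last by lia.
rewrite (big_cat_nat (m := s') (n := t') (p := t)) //=; last by lia.
by rewrite ler_wpDl ?sumr_ge0 // lerDl sumr_ge0.
Qed.

(** Greedy: the first cut is the least [e1] at which the sum from [s] exceeds [eta], so every cut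
    uses up more than [eta] of [theta]. *)
Lemma cuts_sum (f : nat -> R) (eta theta : R) s e : (forall u, 0 <= f u) ->
  0 < eta -> \sum_(s <= u < e) f u <= theta ->
  exists2 L : seq nat, (size L)%:R * eta <= theta
    & forall s' e', (s <= s')%N -> (e' <= e)%N -> nocut L s' e' ->
      \sum_(s' <= u < e') f u <= eta.
Proof.
move=> f0 eta0; have [n] := ubnP (e - s).
elim: n => // n IH in s theta *; move=> hn hth.
have [small|big] := leP (\sum_(s <= u < e) f u) eta.
  exists [::]; first by rewrite mul0r; apply: le_trans hth; apply: sumr_ge0.
  by move=> s' e' ss ee _; apply: le_trans small; apply: sum_nat_sub.
have ex : exists t, (s <= t)%N && (eta < \sum_(s <= u < t) f u).
  exists e; rewrite big andbT leqNgt; apply/negP => es.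
  by move: big; rewrite big_geq ?(ltnW es) // ltNge ltW.
case: (ex_minnP ex) => e1 /andP[se1 big1] min1.
have se1' : (s < e1)%N.
  rewrite ltn_neqAle se1 andbT; apply/eqP => E; move: big1.
  by rewrite E big_geq // ltNge ltW.
have e1e : (e1 <= e)%N.
  apply: min1; rewrite big andbT leqNgt; apply/negP => es.
  by move: big; rewrite big_geq ?(ltnW es) // ltNge ltW.
have [] := IH e1 (theta - eta); first by lia.
  rewrite lerBrDr; apply: le_trans hth.
  rewrite [X in _ <= X](big_cat_nat (m := s) (n := e1)) //=.
  by rewrite [X in _ <= X]addrC lerD2l ltW.
move=> L sL hL; exists (e1 :: L).
  by rewrite /= -natr1 mulrDl mul1r -lerBrDr.
move=> s' e' ss ee /= /andP[nc ncL].
case: (leqP e1 s') => h; first by apply: hL.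
have e'e1 : (e' < e1)%N by lia.
(* The piece ends before [e1], and minimality of [e1] bounds the sum up to [e1.-1] by [eta]. *)
apply: (@le_trans _ _ (\sum_(s <= u < e1.-1) f u)).
  by apply: sum_nat_sub => //; lia.
rewrite leNgt; apply/negP => bad.
have := min1 e1.-1; rewrite bad andbT => /(_ _); lia.
Qed.

Lemma nocut_cat L1 L2 s e : nocut (L1 ++ L2) s e = nocut L1 s e && nocut L2 s e.
Proof. exact: all_cat. Qed.

Lemma nocut_union (T : eqType) (l : seq T) (c : R) (Q : T -> nat -> nat -> Prop) :
  (forall x, x \in l -> exists2 L : seq nat, (size L)%:R <= c
     & forall s e, nocut L s e -> Q x s e) ->
  exists2 L : seq nat, (size L)%:R <= (size l)%:R * c
    & forall x, x \in l -> forall s e, nocut L s e -> Q x s e.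
Proof.
elim: l => [|y l IH] h; first by exists [::]; rewrite ?mul0r.
have [x xl|L1 s1 h1] := IH; first by apply: h; rewrite inE xl orbT.
have [|L2 s2 h2] := h y; first by rewrite inE eqxx.
exists (L2 ++ L1).
  by rewrite size_cat natrD /= -natr1 mulrDl mul1r addrC lerD.
move=> x; rewrite inE => /orP[/eqP ->|xl] s e; rewrite nocut_cat => /andP[a b].
  exact: h2.
exact: h1.
Qed.

End Cuts.

(** * Cheap tuples, and boundedly many cuts that keep them cheap *)

Section Dichotomy.
Variables (R : realType) (U : finType) (d : nat) (k : 'I_d -> nat).
Variable w : 'I_d -> R.
Hypothesis w_gt0 : forall i, 0 < w i.
Variable rq : nat -> U.

Local Notation tup := (tup U d).
Local Notation K := (ksum k).
Implicit Types T V B : tup.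

Definition wt (i : 'I_d) : R := (k i)%:R * w i.

Definition Wlt (m : nat) : R := \sum_(i < d | (i < m)%N) wt i.

(* At time [u] all classes below [z u] may move and all of them are charged; this
   overcharges a real path at most by the factor [ksum k], see [topdiff_cost]. *)
Definition servable (j s t : nat) (theta : R) (T : tup) : Prop :=
  exists2 z : nat -> nat, \sum_(s <= u < t) Wlt (z u) <= theta
    & fam k rq z j s t T.

Lemma wt_ge0 i : 0 <= wt i.
Proof. by rewrite mulr_ge0 // ltW. Qed.

Lemma Wlt_ge0 m : 0 <= Wlt m.
Proof. by apply: sumr_ge0 => i _; apply: wt_ge0. Qed.

Lemma Wlt0 : Wlt 0 = 0.
Proof. by rewrite /Wlt big_pred0. Qed.

Lemma WltS m (i0 : 'I_d) : i0 = m :> nat -> Wlt m.+1 = Wlt m + wt i0.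
Proof.
move=> im; rewrite /Wlt (bigD1 i0) /=; last by rewrite im.
rewrite addrC; congr (_ + _); apply: eq_bigl => i.
rewrite ltnS andbC; apply/andP/idP => [[ne le]|lt].
  rewrite ltn_neqAle le andbT; apply/eqP => E; move/eqP: ne; apply.
  by apply: val_inj; rewrite /= E.
by split; [apply/eqP => E; move: lt; rewrite E im ltnn|apply: ltnW].
Qed.

Lemma Wlt_max a b : Wlt (maxn a b) <= Wlt a + Wlt b.
Proof.
case: (leqP a b) => _; first by rewrite lerDr Wlt_ge0.
by rewrite lerDl Wlt_ge0.
Qed.

Lemma servable_sub j s t s' t' th th' T : (s <= s')%N -> (t' <= t)%N -> th <= th' ->
  servable j s t th T -> servable j s' t' th' T.
Proof.
move=> ss tt hh [z hz hf]; exists z; last exact: fam_sub hf.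
apply: le_trans hh; apply: le_trans hz; apply: sum_nat_sub => // u.
exact: Wlt_ge0.
Qed.

Lemma servable_mono j s t th T T' : tle T T' -> valid k j T' ->
  servable j s t th T -> servable j s t th T'.
Proof.
move=> /tleP tT vT' [z hz hf]; exists z => //.
by apply: fam_mono hf.
Qed.

Lemma servable_empty j s t th T : (t <= s)%N -> 0 <= th -> servable j s t th T.
Proof.
move=> ts th0; exists (fun=> 0%N); first by rewrite big_geq.
by exists (fun=> T) => [u|v]; lia.
Qed.

(** A single request involves no move between two served times, so the pattern may be constantly
    0. *)
Lemma servable_single j t th T : servable j t t.+1 th T -> servable j t t.+1 0 T.
Proof.
move=> [z _ [x h1 h2]]; exists (fun=> 0%N).
  by rewrite big_nat1 Wlt0.
by exists x => // v; lia.
Qed.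

Lemma servable_level0 s t th T : servable 0 s t th T -> servable 0 s t 0 T.
Proof.
move=> [z _ [x h1 h2]]; exists (fun=> 0%N).
  by rewrite Wlt0 big1_eq.
exists x => // v v1 v2 i _.
have [|_ -> // _] := h1 v.+1; first by lia.
by have [|_ -> // _] := h1 v; first by lia.
Qed.

(** The pointwise maximum of the patterns suits all the tuples at once, and [Wlt] of a maximum is at
    most the sum. *)
Lemma servable_join j s t th (l : seq tup) :
  (forall T, T \in l -> valid k j T /\ servable j s t th T) ->
  exists2 z : nat -> nat, \sum_(s <= u < t) Wlt (z u) <= (size l)%:R * th
    & forall T, T \in l -> fam k rq z j s t T.
Proof.
elim: l => [|T l IH] h.
  by exists (fun=> 0%N) => //; rewrite Wlt0 big1_eq mul0r.
have [T' T'l|z hz fz] := IH; first by apply: h; rewrite inE T'l orbT.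
have [|vT [y hy fy]] := h T; first by rewrite inE eqxx.
exists (fun u => maxn (y u) (z u)).
  rewrite /= -natr1 mulrDl mul1r addrC.
  apply: le_trans (lerD hy hz); rewrite -big_split /=.
  by apply: ler_sum => u _; apply: Wlt_max.
move=> T'; rewrite inE => /orP[/eqP ->|T'l].
  by apply: fam_mono fy => // u; apply: leq_maxl.
have [|vT' _] := h T'; first by rewrite inE T'l orbT.
by apply: fam_mono (fz _ T'l) => // u; apply: leq_maxr.
Qed.

Definition nmin (j : nat) : nat := (2 ^ (d * kprod k j)) ^ K.

(** With [a] the inverse of [2 ^+ d] one has [d%:R * a <= 1]. Growth is at most [K], so each listed
    tuple has Kraft weight at least the inverse of [nmin j]. *)
Lemma fam_cover z j s t T : (j <= d)%N -> valid k j T ->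
  exists L : seq tup, [/\ (size L <= nmin j)%N,
    forall T', T' \in L -> [/\ valid k j T', tle T T' & fam k rq z j s t T']
  & forall T', valid k j T' -> tle T T' -> fam k rq z j s t T' ->
      exists2 T'', T'' \in L & tle T'' T'].
Proof.
move=> jd vT.
pose a : R := (2 ^+ d)^-1.
have a0 : 0 < a by rewrite invr_gt0 exprn_gt0.
have a1 : a <= 1 by rewrite invf_le1 ?exprn_gt0 // exprn_ege1 // ler1n.
have da : d%:R * a <= 1.
  rewrite ler_pdivrMr ?exprn_gt0 // mul1r -natrX ler_nat.
  exact/ltnW/ltn_expl.
have [L [h1 h2 h3]] := fam_branching rq z s t a0 a1 da jd vT.
exists L; split=> //; rewrite -(ler_nat R).
have b0 : 0 < a ^+ kprod k j by apply: exprn_gt0.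
have b1 : a ^+ kprod k j <= 1 by apply: exprn_ile1 => //; apply: ltW.
have : (size L)%:R * (a ^+ kprod k j) ^+ K <= 1.
  apply: le_trans h3; rewrite mulr_natl.
  have -> : (a ^+ kprod k j) ^+ K *+ size L = \sum_(T' <- L) (a ^+ kprod k j) ^+ K.
    by rewrite big_const_seq count_predT iter_addr addr0.
  rewrite big_seq [X in _ <= X]big_seq; apply: ler_sum => T' /h1 [vT' _ _].
  apply: ler_wiXn2l => //; first exact: ltW.
  by have := valid_tsz vT'; lia.
have -> : (nmin j)%:R = ((a ^+ kprod k j) ^+ K)^-1.
  by rewrite /nmin !natrX exprM /a !exprVn invrK.
by rewrite -ler_pdivlMr ?exprn_gt0 // div1r.
Qed.

(* The ratio of consecutive thresholds is what the common refinement of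
   [(nmin j).+1] patterns costs. *)
Definition thr (j : nat) (th : R) (r : nat) : R := th * (nmin j).+1%:R ^+ (K - r).

Lemma thr_anti j th r r' : 0 <= th -> (r <= r')%N -> thr j th r' <= thr j th r.
Proof.
move=> th0 rr; rewrite ler_wpM2l // ler_weXn2l ?ler1n //; lia.
Qed.

Lemma thr_le j th r : 0 <= th -> th <= thr j th r.
Proof.
by move=> th0; rewrite -[X in X <= _]mulr1 ler_wpM2l // exprn_ege1 // ler1n.
Qed.

Lemma size_flatten_le (I T : Type) (f : I -> seq T) c (r : seq I) :
  (forall i, (size (f i) <= c)%N) ->
  (size (flatten (map f r)) <= size r * c)%N.
Proof.
move=> h; elim: r => //= i r IH; rewrite size_cat mulSn.
exact: leq_add.
Qed.

(** The list collects the minimal cheap tuples above [T], size by size. If more than [nmin j] of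
    them had size [q], a common pattern for [(nmin j).+1] of them would cost at most the threshold
    of size [q.-1]. A cover of at most [nmin j] tuples for that pattern must contain a tuple
    strictly below one of them; that tuple is cheap as well, against minimality. *)
Lemma dichotomy j tau t th T : (j <= d)%N -> 0 <= th -> valid k j T ->
  ~ servable j tau t (thr j th (tsz T)) T ->
  exists l : seq tup, [/\ (size l <= K.+1 * nmin j)%N,
    forall T', T' \in l -> [/\ valid k j T', tle T T' & (tsz T < tsz T')%N]
  & forall B, valid k j B -> tle T B -> servable j tau t th B ->
      exists2 T', T' \in l & tle T' B].
Proof.
move=> jd th0 vT nT.
pose good V := `[< servable j tau t (thr j th (tsz V)) V >].
pose cand V := [&& valid k j V, tle T V, V != T & good V].
pose M q := [set V | [&& cand V, tsz V == q
  & [forall V', cand V' && tle V' V ==> (V' == V)]]].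
have Mq q : (#|M q| <= nmin j)%N.
  rewrite leqNgt; apply/negP => big.
  pose l := take (nmin j).+1 (enum (M q)).
  have sl : size l = (nmin j).+1.
    by rewrite size_take -cardE; case: ltnP => // h; apply/eqP; rewrite eqn_leq h.
  have ul : uniq l by rewrite take_uniq // enum_uniq.
  have lM V : V \in l -> V \in M q by move=> /mem_take; rewrite mem_enum.
  have [V Vl|z hz fz] := @servable_join j tau t (thr j th q) l.
    have := lM _ Vl; rewrite inE => /and3P[/and4P[vV _ _ /asboolP gV] /eqP Vq _].
    by split=> //; rewrite -Vq.
  have [L [sL h1 h2]] := fam_cover z tau t jd vT.
  have /(uniq_leq_size ul) : {subset l <= L}; last by rewrite sl ltnNge sL.
  move=> V Vl; have := lM _ Vl; rewrite inE.
  move=> /and3P[/and4P[vV tV nV gV] /eqP Vq /forallP minV].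
  have [T'' T''L tT''] := h2 V vV tV (fz _ Vl).
  have [v'' t'' f''] := h1 _ T''L.
  case: (leqP q (tsz T'')) => hq.
    by rewrite -(@tle_eq _ _ T'' V) // Vq.
  have c'' : servable j tau t (thr j th (tsz T'')) T''.
    exists z => //; apply: (le_trans hz).
    have qK : (q <= K)%N by rewrite -Vq; apply: valid_tsz vV.
    apply: (@le_trans _ _ (thr j th q.-1)); last first.
      by apply: thr_anti; rewrite // -ltnS (ltn_predK hq).
    rewrite sl /thr mulrCA ler_wpM2l //.
    have -> : (K - q.-1 = (K - q).+1)%N by rewrite -subnSK (ltn_predK hq).
    by rewrite exprS.
  have := minV T''; rewrite tT'' andbT.
  have -> : cand T''.
    rewrite /cand v'' t'' /=; apply/andP; split; last exact/asboolP.
    by apply/eqP => E; apply: nT; rewrite -E.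
  by move=> /eqP E; rewrite -E.
exists (flatten [seq enum (M q) | q <- iota 0 K.+1]); split.
- rewrite -[X in (_ <= X * _)%N](size_iota 0 K.+1); apply: size_flatten_le => q.
  by rewrite -cardE.
- move=> V /flatten_mapP[q _]; rewrite mem_enum inE.
  move=> /and3P[/and4P[vV tV nV _] _ _]; split=> //.
  by apply: tle_lt => // E; rewrite E eqxx in nV.
- move=> B vB tB gB.
  have cB : cand B && tle B B.
    rewrite /cand vB tB tle_refl andbT /=; apply/andP; split.
      apply/eqP => E; apply: nT; rewrite -E.
      by apply: servable_sub gB => //; apply: thr_le.
    by apply/asboolP; apply: servable_sub gB => //; apply: thr_le.
  pose P V := cand V && tle V B.
  case: (@arg_minnP _ B P (@tsz _ _) cB) => V /andP[cV tVB] minV.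
  exists V => //; apply/flatten_mapP; exists (tsz V).
    rewrite mem_iota /= add0n ltnS; apply: (@valid_tsz _ _ k j).
    by case/and4P: cV.
  rewrite mem_enum inE cV eqxx /=; apply/forallP => V'.
  apply/implyP => /andP[cV' tV']; apply/eqP; apply: tle_eq => //.
  by apply: minV; rewrite /P cV' /=; apply: tle_trans tVB.
Qed.

(* Once [T] is no longer cheap on [[tau, t0)], the dichotomy replaces it by a
   bounded number of larger tuples, so the recursion is on the size of [T]. *)
Lemma cuts_above j tau th eta n T s e : (j <= d)%N -> 0 <= th -> 0 < eta ->
  (tau <= s)%N -> valid k j T -> (K - tsz T < n)%N ->
  exists2 L : seq nat,
    (size L)%:R <= (thr j th 0 / eta + 1) * (K.+1 * nmin j).+1%:R ^+ n
  & forall s' e', nocut L s' e' -> (s <= s')%N -> (e' <= e)%N ->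
      forall B, valid k j B -> tle T B -> servable j tau s' th B -> servable j s' e' eta B.
Proof.
move=> jd th0 eta0 taus.
have x0 : 0 <= thr j th 0 / eta.
  by rewrite divr_ge0 ?(ltW eta0) // (le_trans th0) // thr_le.
have p1 m : 1 <= (K.+1 * nmin j).+1%:R ^+ m :> R by rewrite exprn_ege1 // ler1n.
have cheap T0 e0 : servable j tau e0 (thr j th (tsz T0)) T0 ->
  exists2 L : seq nat, (size L)%:R <= thr j th 0 / eta
  & forall s' e', nocut L s' e' -> (s <= s')%N -> (e' <= e0)%N ->
      forall B, valid k j B -> tle T0 B -> servable j s' e' eta B.
  move=> [z hz fz].
  have hz' : \sum_(s <= u < e0) Wlt (z u) <= thr j th 0.
    apply: le_trans (sum_nat_sub _ taus (leqnn e0)) _ => [u|].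
      exact: Wlt_ge0.
    by apply: le_trans hz _; apply: thr_anti.
  have [L sL hL] := cuts_sum (fun u => Wlt_ge0 (z u)) eta0 hz'.
  exists L; first by rewrite ler_pdivlMr.
  move=> s' e' nc ss ee B vB tB; apply: (servable_mono tB vB).
  exists z; first exact: hL.
  by apply: fam_sub fz => //; apply: leq_trans ss.
elim: n T => // n IH T vT hn.
have [gT|nT] := pselect (servable j tau e (thr j th (tsz T)) T).
  have [L sL hL] := cheap _ _ gT; exists L.
    apply: le_trans sL _; apply: (@le_trans _ _ (thr j th 0 / eta + 1)).
      by rewrite lerDl.
    by rewrite ler_peMr // addr_ge0.
  by move=> s' e' nc ss ee B vB tB _; apply: hL tB.
have ex : exists t, ~~ `[< servable j tau t (thr j th (tsz T)) T >].
  by exists e; apply/asboolPn.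
(* Before [t0] the pattern of [T] itself is cut; from [t0] on every cheap [B] lies above a tuple
   supplied by the dichotomy. *)
case: (ex_minnP ex) => t0 /asboolPn nt0 min0.
have thT : 0 <= thr j th (tsz T) by rewrite (le_trans th0) ?thr_le.
have tau0 : (tau < t0)%N.
  by rewrite ltnNge; apply/negP => h; apply: nt0; apply: servable_empty.
have gt0 : servable j tau t0.-1 (thr j th (tsz T)) T.
  apply: contrapT => h; have := min0 t0.-1; move/asboolPn: h => -> /(_ isT); lia.
have [L1 sL1 hL1] := cheap _ _ gt0.
have [l [sl l1 l2]] := dichotomy jd th0 vT nt0.
have [T' T'l|L2 sL2 hL2] := @nocut_union R _ l
  ((thr j th 0 / eta + 1) * (K.+1 * nmin j).+1%:R ^+ n)
  (fun T' s' e' => (s <= s')%N -> (e' <= e)%N ->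
    forall B, valid k j B -> tle T' B -> servable j tau s' th B -> servable j s' e' eta B).
  have [v' t' z'] := l1 _ T'l; apply: IH => //.
  by have := valid_tsz v'; clear -z' hn; lia.
(* The cut at [t0] puts each piece on one side: it ends before [t0] or starts at [t0] or later. *)
exists (t0 :: L1 ++ L2).
  rewrite /= size_cat -natr1 natrD exprS.
  set y := _ ^+ n; have y1 : 1 <= y by apply: p1.
  set x := thr j th 0 / eta in x0 sL1 sL2 *.
  apply: (@le_trans _ _ (x + 1 + (K.+1 * nmin j)%:R * ((x + 1) * y))).
    have : (size L2)%:R <= (K.+1 * nmin j)%:R * ((x + 1) * y).
      apply: le_trans sL2 _; apply: ler_wpM2r.
        by apply: mulr_ge0; [exact: addr_ge0|exact: le_trans y1].
      by rewrite ler_nat.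
    lra.
  rewrite -natr1; have : 0 <= x * (y - 1) by apply: mulr_ge0; rewrite ?subr_ge0.
  lra.
move=> s' e' /=; rewrite nocut_cat => /and3P[nc nc1 nc2] ss ee B vB tB gB.
case: (leqP t0 s') => h.
  have [|T' T'l tT'] := l2 B vB tB; first by apply: servable_sub gB.
  exact: (hL2 _ T'l _ _ nc2 ss ee B vB tT' gB).
by apply: (hL1 _ _ nc1 ss _ B vB tB); clear -nc h; lia.
Qed.

Definition ncuts (j : nat) (th eta : R) : R :=
  (thr j th 0 / eta + 1) * (K.+1 * nmin j).+1%:R ^+ K.+1.

(** The empty tuple lies below every valid one, so a single start of the recursion suffices. *)
Lemma cuts_main j th eta s e : (j <= d)%N -> 0 <= th -> 0 < eta ->
  exists2 L : seq nat, (size L)%:R <= ncuts j th eta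
  & forall s' e', nocut L s' e' -> (s <= s')%N -> (e' <= e)%N ->
      forall B, valid k j B -> servable j s s' th B -> servable j s' e' eta B.
Proof.
move=> jd th0 eta0; pose T0 : tup := [ffun=> set0].
have v0 : valid k j T0.
  by apply/forallP => i; rewrite ffunE; case: ifP => // _; rewrite cards0.
have [|L sL hL] := @cuts_above j s th eta K.+1 T0 s e jd th0 eta0 (leqnn s) v0.
  by lia.
exists L => // s' e' nc ss ee B vB; apply: hL => //.
by apply/tleP => i; rewrite ffunE sub0set.
Qed.

End Dichotomy.

(** * Distances between configurations and their parts in the heavy classes *)

Section Distances.
Variables (R : realType) (U : finType) (d : nat) (k : 'I_d -> nat).
Variable w : 'I_d -> R.
Hypothesis w_gt0 : forall i, 0 < w i.
Hypothesis k_gt0 : forall i, (0 < k i)%N.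
Hypothesis w_incr : forall i j : 'I_d, (i < j)%N -> w i < w j.

Local Notation conf := (config U k).
Local Notation dist := (@conf_dist R U d k w).
Local Notation K := (ksum k).
Local Notation Wlt := (Wlt k w).
Local Notation wt := (wt k w).
Implicit Types A B : conf.

Definition agree (j : nat) A B :=
  forall i : 'I_d, (j <= i)%N -> servers A i = servers B i.

Definition dge (j : nat) A B : R :=
  \sum_(i < d | (j <= i)%N) wt i * (servers A i != servers B i)%:R.

Definition restr (j : nat) A : tup U d :=
  [ffun i : 'I_d => if (i < j)%N then set0 else servers A i].

Lemma card_servers A i : #|servers A i| = k i.
Proof. by have /forallP /(_ i) /eqP := valP A. Qed.

Lemma conf_inj A B : (forall i, servers A i = servers B i) -> A = B.
Proof. by move=> h; apply: val_inj; apply/ffunP. Qed.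

Lemma restr_valid j A : valid k j (restr j A).
Proof.
by apply/forallP => i; rewrite ffunE; case: (ltnP i j); rewrite ?eqxx ?card_servers.
Qed.

Lemma restr_agree j A B : agree j A B -> restr j A = restr j B.
Proof.
by move=> h; apply/ffunP => i; rewrite !ffunE; case: ltnP => // ji; apply: h.
Qed.

Lemma dist_ge0 A B : 0 <= dist A B.
Proof. by apply: sumr_ge0 => i _; apply: mulr_ge0 => //; apply: wt_ge0. Qed.

Lemma distxx A : dist A A = 0.
Proof. by apply: big1 => i _; rewrite eqxx mulr0. Qed.

Lemma distC A B : dist A B = dist B A.
Proof. by apply: eq_bigr => i _; rewrite eq_sym. Qed.

Lemma neq_triangle (T : eqType) (a b c : T) :
  (a != c)%:R <= (a != b)%:R + (b != c)%:R :> R.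
Proof.
case: (eqVneq a b) => [->|_]; first by rewrite add0r.
by rewrite -natrD ler_nat; case: eqP.
Qed.

Lemma dist_triangle A B B' : dist A B' <= dist A B + dist B B'.
Proof.
rewrite -big_split /=; apply: ler_sum => i _; rewrite -mulrDr.
by apply: ler_wpM2l; [apply: wt_ge0|apply: neq_triangle].
Qed.

Lemma dge_triangle j A B B' : dge j A B' <= dge j A B + dge j B B'.
Proof.
rewrite -big_split /=; apply: ler_sum => i _; rewrite -mulrDr.
by apply: ler_wpM2l; [apply: wt_ge0|apply: neq_triangle].
Qed.

Lemma dge_le_dist j A B : dge j A B <= dist A B.
Proof.
rewrite /dge big_mkcond; apply: ler_sum => i _; case: ifP => // _.
by apply: mulr_ge0 => //; apply: wt_ge0.
Qed.

Lemma dist_le_dge j A B : dist A B <= Wlt j + dge j A B.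
Proof.
rewrite /Wlt /dge [X in _ <= X + _]big_mkcond [X in _ <= _ + X]big_mkcond.
rewrite -big_split /=; apply: ler_sum => i _.
case: (ltnP i j) => h; last by rewrite add0r.
rewrite addr0 -[X in _ <= X]mulr1 ler_wpM2l ?wt_ge0 //.
by rewrite lern1; case: (_ != _).
Qed.

Lemma dge_agree j A B : agree j A B -> dge j A B = 0.
Proof. by move=> h; apply: big1 => i ji; rewrite h // eqxx mulr0. Qed.

Lemma dist_agree j A B : agree j A B -> dist A B <= Wlt j.
Proof. by move=> h; apply: le_trans (dist_le_dge j A B) _; rewrite dge_agree ?addr0. Qed.

Lemma dist_le_all A B : dist A B <= Wlt d.
Proof. by apply: dist_agree => i; rewrite leqNgt ltn_ord. Qed.

Lemma w_le_wt i : w i <= wt i.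
Proof. by rewrite /wt ler_peMl ?ler1n // ltW. Qed.

Lemma w_le (i j : 'I_d) : (i <= j)%N -> w i <= w j.
Proof.
rewrite leq_eqVlt => /orP[/eqP E|/w_incr/ltW //].
by have -> : i = j by apply: val_inj.
Qed.

(** Weights increase with the class and every class has a server, so a change in any class from [j]
    on costs at least [w i0]. *)
Lemma dge_small (i0 : 'I_d) j A B : i0 = j :> nat -> dge j A B < w i0 -> agree j A B.
Proof.
move=> ij small i ji; apply/eqP; apply: contraTT small => ne.
rewrite -leNgt /dge (bigD1 i) //= ne mulr1.
apply: ler_wpDr; last by apply: le_trans (w_le_wt i); apply: w_le; rewrite ij.
by apply: sumr_ge0 => i' _; apply: mulr_ge0 => //; apply: wt_ge0.
Qed.

Lemma dist_eq0 A B : dist A B <= 0 -> A = B.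
Proof.
move=> h; apply: conf_inj => i; apply/eqP; apply: contraTT h => ne.
rewrite -ltNge /conf_dist (bigD1 i) //= ne mulr1.
apply: ltr_wpDr; last by rewrite mulr_gt0 // ltr0n.
by apply: sumr_ge0 => i' _; apply: mulr_ge0 => //; apply: wt_ge0.
Qed.

Lemma Wlt_le_w (i0 : 'I_d) : Wlt i0.+1 <= K%:R * w i0.
Proof.
rewrite /Wlt /ksum natr_sum mulr_suml big_mkcond; apply: ler_sum => i _.
case: ifP => [ii|_]; last by rewrite mulr_ge0 // ltW.
by rewrite ler_wpM2l // w_le.
Qed.

(** One more than the heaviest differing class, and 0 if none differs, to match [Wlt] and the
    patterns [z], which refer to the classes below a number. *)
Definition topdiff A B : nat :=
  \max_(i < d | servers A i != servers B i) i.+1.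

Lemma topdiffP A B (i : 'I_d) : (topdiff A B <= i)%N -> servers A i = servers B i.
Proof.
move=> h; apply/eqP; apply: contraTT h => ne; rewrite -ltnNge.
exact: (@leq_bigmax_cond _ (fun i : 'I_d => servers A i != servers B i)
  (fun i : 'I_d => i.+1)).
Qed.

(** The heaviest differing class [i] costs at least [w i], and all classes up to [i] together weigh
    at most [K%:R * w i]. *)
Lemma topdiff_cost A B : Wlt (topdiff A B) <= K%:R * dist A B.
Proof.
case: (pickP (fun i : 'I_d => servers A i != servers B i)) => [i1 ne1|all_eq].
  have [i ne E] : exists2 i : 'I_d, servers A i != servers B i
      & topdiff A B = i.+1.
    have [|i /= ne E] := @eq_bigmax_cond _
      [pred i : 'I_d | servers A i != servers B i] (fun i : 'I_d => i.+1).
      by apply/card_gt0P; exists i1.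
    by exists i.
  rewrite E; apply: le_trans (Wlt_le_w i) _; rewrite ler_wpM2l //.
  apply: le_trans (w_le_wt i) _; rewrite /conf_dist (bigD1 i) //= ne mulr1.
  rewrite lerDl; apply: sumr_ge0 => i' _; apply: mulr_ge0 => //.
  exact: wt_ge0.
rewrite /topdiff big_pred0 // Wlt0 mulr_ge0 // dist_ge0 //.
Qed.

Lemma set_extend (m : nat) (S : {set U}) : (#|S| + m <= #|U|)%N ->
  exists2 S' : {set U}, S \subset S' & #|S'| = (#|S| + m)%N.
Proof.
elim: m S => [|m IH] S h; first by exists S; rewrite ?addn0.
have [x xS] : exists x, x \notin S.
  apply/existsP; rewrite -negb_forall; apply/negP => /forallP all_in.
  have : #|U| = #|S| by apply: eq_card => y; rewrite all_in.
  by lia.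
have [|S' sub cS'] := IH (x |: S); first by rewrite cardsU1 xS; lia.
exists S'; first by apply: subset_trans sub; apply: subsetUr.
by rewrite cS' cardsU1 xS; lia.
Qed.

(** The completion of a set depends only on its class and the set itself; hence a class at rest in a
    pattern stays at rest after completion. *)
Lemma conf_extend (C0 : conf) : exists f : tup U d -> conf,
  (forall x : tup U d, (forall i, (#|x i| <= k i)%N) ->
     forall i, x i \subset servers (f x) i) /\
  (forall x y : tup U d, (forall i, (#|x i| <= k i)%N) -> (forall i, (#|y i| <= k i)%N) ->
     forall i, x i = y i -> servers (f x) i = servers (f y) i).
Proof.
have /choice [e eP] : forall p : 'I_d * {set U}, exists S' : {set U},
    (#|p.2| <= k p.1)%N -> p.2 \subset S' /\ #|S'| = k p.1.
  move=> [i S] /=; case: (leqP #|S| (k i)) => h; last by exists set0.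
  have kU : (k i <= #|U|)%N by rewrite -(card_servers C0 i); apply: max_card.
  have [|S' sub cS'] := @set_extend (k i - #|S|) S; first by lia.
  by exists S' => _; split=> //; rewrite cS'; lia.
have /choice [f fP] : forall x : tup U d, exists Y : conf,
    (forall i, (#|x i| <= k i)%N) -> forall i, servers Y i = e (i, x i).
  move=> x; have [h|nh] := pselect (forall i, (#|x i| <= k i)%N); last first.
    by exists C0.
  have v : [forall i, #|[ffun i => e (i, x i)] i| == k i].
    by apply/forallP => i; rewrite ffunE; have [_ ->] := eP (i, x i) (h i).
  exists (exist (fun Y : {ffun 'I_d -> {set U}} => [forall i, #|Y i| == k i]) _ v).
  by move=> _ i; rewrite /servers /= ffunE.
exists f; split=> [x hx i|x y hx hy i E].
  by rewrite fP //; have [] := eP (i, x i) (hx i).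
by rewrite !fP // E.
Qed.

End Distances.

(* Hypotheses about real numbers in the context make [lia] very slow. *)
Ltac nlia := repeat match goal with
  | H : ?P |- _ => lazymatch P with
    | is_true (_ <= _)%N => fail | is_true (_ && _) => fail
    | is_true (~~ _) => fail | @eq nat _ _ => fail | nat => fail
    | _ => clear H
    end
  end; lia.

(** * Work functions along paths, with the needed properties as hypotheses *)

Section WorkFunction.
Variables (R : realType) (U : finType) (d : nat) (k : 'I_d -> nat).
Variable w : 'I_d -> R.
Hypothesis w_gt0 : forall i, 0 < w i.
Hypothesis k_gt0 : forall i, (0 < k i)%N.
Hypothesis w_incr : forall i j : 'I_d, (i < j)%N -> w i < w j.

Local Notation conf := (config U k).
Local Notation dist := (@conf_dist R U d k w).
Local Notation K := (ksum k).
Local Notation Wlt := (Wlt k w).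

Variables (rq : nat -> U) (WF : nat -> conf -> R) (C : nat -> conf).
Hypothesis WF_le : forall t X Y,
  serves (rq t) X -> WF t.+1 Y <= WF t X + dist X Y.
Hypothesis WF_att : forall t Y,
  exists2 X, serves (rq t) X & WF t X + dist X Y <= WF t.+1 Y.
Hypothesis WF_lip : forall t X Y, WF t Y <= WF t X + dist X Y.
Hypothesis alg_min : forall t X, WF t (C t) <= WF t X + 1 / 2 * dist X (C t).

Local Notation servable := (servable k w rq).

Let dist_ge0 := @dist_ge0 R U d k w w_gt0.
Let Wlt_ge0 := @Wlt_ge0 R d k w w_gt0.

Lemma WF_mono t X : WF t X <= WF t.+1 X.
Proof. by have [Y _ h] := WF_att t X; apply: le_trans h; apply: WF_lip. Qed.

Lemma WF_monoN s t X : (s <= t)%N -> WF s X <= WF t X.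
Proof.
elim: t => [|t IH]; first by rewrite leqn0 => /eqP ->.
rewrite leq_eqVlt => /orP[/eqP -> //|]; rewrite ltnS => /IH /le_trans; apply.
exact: WF_mono.
Qed.

Definition pc (X : nat -> conf) s t : R :=
  \sum_(s <= u < t) dist (X u) (X u.+1).

(** Shifted by one: [X u.+1] answers [rq u], and [X s] is the position before the interval. *)
Definition serving (X : nat -> conf) s t :=
  forall u, (s <= u < t)%N -> serves (rq u) (X u.+1).

Lemma serving_sub X s t s' t' : (s <= s')%N -> (t' <= t)%N ->
  serving X s t -> serving X s' t'.
Proof. by move=> ss tt h u hu; apply: h; lia. Qed.

Lemma pc_ge0 X s t : 0 <= pc X s t.
Proof. by apply: sumr_ge0 => u _; apply: dist_ge0. Qed.

Lemma pc_cat X s u t : (s <= u)%N -> (u <= t)%N ->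
  pc X s t = pc X s u + pc X u t.
Proof. by move=> su ut; rewrite /pc (big_cat_nat (m := s) (n := u)). Qed.

Lemma dge_pc j X s t : (s <= t)%N -> dge w j (X s) (X t) <= pc X s t.
Proof.
move=> st; rewrite -(subnKC st); elim: (t - s)%N => [|n IH].
  by rewrite addn0 dge_agree // pc_ge0.
rewrite addnS (pc_cat X (u := s + n)) ?leq_addr //; apply: le_trans
  (@dge_triangle R U d k w w_gt0 j _ (X (s + n)%N) _) _.
rewrite lerD // /pc big_nat1; exact: dge_le_dist.
Qed.

Lemma WF_path X s t : (s <= t)%N -> serving X s t ->
  WF t (X t) <= WF s (X s) + pc X s t.
Proof.
move=> st; rewrite -(subnKC st); elim: (t - s)%N => [|n IH] sv.
  by rewrite addn0 /pc big_geq // addr0.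
rewrite addnS in sv *.
rewrite (pc_cat X (u := s + n)) ?leq_addr // [X in _ + (_ + X)]/pc big_nat1.
have sX : serves (rq (s + n)) (X (s + n).+1) by apply: sv; lia.
have := WF_le (X (s + n).+1) sX; rewrite distxx addr0 => h1.
have h2 := WF_lip (s + n) (X (s + n)%N) (X (s + n).+1).
have h3 : WF (s + n) (X (s + n)%N) <= WF s (X s) + pc X s (s + n).
  by apply: IH; apply: serving_sub sv.
lra.
Qed.

Lemma WF_opt s t Y : (s <= t)%N -> exists2 X, serving X s t
  & WF s (X s) + (pc X s t + dist (X t) Y) <= WF t Y.
Proof.
move=> st; rewrite -(subnKC st); elim: (t - s)%N Y => [|n IH] Y.
  exists (fun=> Y); first by move=> u; lia.
  by rewrite /pc big_geq ?addn0 // add0r distxx addr0.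
have [Y' sY' h] := WF_att (s + n) Y.
have [X sX hX] := IH Y'.
exists (fun u => if (u <= s + n)%N then X u else Y').
  move=> u hu; case: (leqP u.+1 (s + n)) => h'.
    by apply: sX; lia.
  by have -> : u = (s + n)%N by lia.
rewrite leq_addr addnS ltnn (pc_cat _ (u := s + n)) ?leq_addr //.
rewrite [X in _ + (_ + X + _)]/pc big_nat1 leqnn ltnn.
have -> : pc (fun u => if (u <= s + n)%N then X u else Y') s (s + n)
    = pc X s (s + n).
  by apply: eq_big_nat => u /andP[_ hu]; rewrite (ltnW hu) hu.
lra.
Qed.

Lemma path_servable j X s t q : serving X s t ->
  (forall u, (s <= u <= t)%N -> agree j (X s) (X u)) ->
  pc X s t <= q -> servable j s t (K%:R * q) (restr j (X s)).
Proof.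
move=> sX ag hq; exists (fun u => topdiff (X u) (X u.+1)).
  apply: le_trans (ler_wpM2l _ hq) => //; rewrite /pc mulr_sumr.
  by apply: ler_sum => u _; apply: topdiff_cost.
exists (fun u => [ffun i => servers (X u.+1) i]).
  move=> u hu; split.
  - by move=> i; rewrite ffunE card_servers.
  - move=> i ji; rewrite !ffunE ltnNge ji /=; apply/esym.
    by apply: ag => //; lia.
  - by have /bigcupP[i _ ri] := sX u hu; exists i; rewrite ffunE.
by move=> v v1 v2 i /topdiffP h; rewrite !ffunE h.
Qed.

Lemma servable_ge0 j s t th T : servable j s t th T -> 0 <= th.
Proof. by move=> [z hz _]; apply: le_trans hz; apply: sumr_ge0. Qed.

(** Enter the completed pattern from [X0] and follow it: the heavy classes already stand right, so
    entering costs at most [Wlt j], and the later moves are paid by the pattern. *)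
Lemma cheap_WF j u t e eta X0 : (u <= t)%N -> (t <= e)%N ->
  servable j u e eta (restr j X0) ->
  exists2 Y, agree j X0 Y & WF t Y <= WF u X0 + Wlt j + eta.
Proof.
move=> ut te g; have eta0 := servable_ge0 g.
move: ut; rewrite leq_eqVlt => /orP[/eqP <-|ut].
  by exists X0 => //; rewrite -addrA lerDl addr_ge0.
move: g => [z hz [x x1 x2]].
have [f [f1 f2]] := conf_extend X0.
have xk v : (u <= v < e)%N -> forall i, (#|x v i| <= k i)%N.
  by move=> hv; have [] := x1 v hv.
(* The heavy sets of [restr j X0] already have full size [k i], so completion adds nothing to
   them. *)
have fag v : (u <= v < e)%N -> agree j X0 (f (x v)).
  move=> hv i ji; have := f1 _ (xk v hv) i; have [_ -> // _] := x1 v hv.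
  rewrite ffunE ltnNge ji /= => sub; apply/eqP; rewrite eqEcard sub.
  by rewrite !card_servers leqnn.
have fsv v : (u <= v < e)%N -> serves (rq v) (f (x v)).
  move=> hv; have [_ _ [i xi]] := x1 v hv; apply/bigcupP; exists i => //.
  exact: (subsetP (f1 _ (xk v hv) i)).
have key v : (u <= v < e)%N ->
    WF v.+1 (f (x v)) <= WF u X0 + Wlt j + \sum_(u <= v' < v.+1) Wlt (z v').
  elim: v => [|v IH] hv.
    have u0 : u = 0%N by lia.
    have := WF_le (f (x 0%N)) (fsv _ hv); rewrite distxx addr0 => h1.
    have h2 := WF_lip 0 X0 (f (x 0%N)).
    have h3 := dist_agree w_gt0 (fag _ hv).
    have : 0 <= \sum_(u <= v' < 1) Wlt (z v') by apply: sumr_ge0.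
    by move: h1 h2; rewrite u0 => h1 h2; lra.
  have := WF_le (f (x v.+1)) (fsv _ hv); rewrite distxx addr0 => h1.
  case: (eqVneq u v.+1) => [E|ne].
    have h2 := WF_lip u X0 (f (x v.+1)).
    have h3 := dist_agree w_gt0 (fag _ hv).
    have h4 : WF u (f (x v.+1)) = WF v.+1 (f (x v.+1)) by rewrite E.
    have : 0 <= \sum_(u <= v' < v.+2) Wlt (z v') by apply: sumr_ge0.
    lra.
  have hv' : (u <= v < e)%N by lia.
  have h2 := WF_lip v.+1 (f (x v)) (f (x v.+1)).
  have h3 : dist (f (x v)) (f (x v.+1)) <= Wlt (z v.+1).
    apply: dist_agree => // i zi; apply: f2; [exact: xk|exact: xk|].
    by apply/esym; apply: x2 => //; lia.
  have h4 := IH hv'.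
  rewrite big_nat_recr /=; last by lia.
  lra.
case: t => [|t] in ut te *; first by lia.
have ht : (u <= t < e)%N by lia.
exists (f (x t)); first exact: fag.
apply: le_trans (key t ht) _; rewrite lerD2l; apply: le_trans hz.
by apply: sum_nat_sub.
Qed.

(** Let P be the cost of the path including its final move to [C t], and compare [C t] with a cheap
    [Y] agreeing with [X u]. Their distance is at most [Wlt j] + P; WFA counts only half of it, so P
    <= 3/2 [Wlt j] + [eta] + P/2. *)
Lemma cheap_path_bounds j X u t e eta : (u <= t)%N -> (t <= e)%N ->
  servable j u e eta (restr j (X u)) ->
  WF u (X u) + (pc X u t + dist (X t) (C t)) <= WF t (C t) ->
  pc X u t + dist (X t) (C t) <= 3 * Wlt j + 2 * eta /\
  WF e (C t) <= WF t (C t) + 2 * Wlt j + eta.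
Proof.
move=> ut te g hv.
have hD : dge w j (X u) (C t) <= pc X u t + dist (X t) (C t).
  apply: le_trans (@dge_triangle R U d k w w_gt0 j _ (X t) _) _.
  by rewrite lerD ?dge_pc //; apply: dge_le_dist.
have dY Y : agree j (X u) Y -> dist Y (C t) <= Wlt j + dge w j (X u) (C t).
  move=> ag; apply: le_trans (@dist_le_dge R U d k w w_gt0 j _ _) _.
  rewrite lerD2l; apply: le_trans (@dge_triangle R U d k w w_gt0 j _ (X u) _) _.
  by rewrite dge_agree ?add0r // => i ji; rewrite ag.
split.
  have [Y ag hY] := cheap_WF ut te g.
  have h1 := alg_min t Y; have h2 := dY Y ag; lra.
have [Y ag hY] := cheap_WF (leq_trans ut te) (leqnn e) g.
have h1 := WF_lip e Y (C t); have h2 := dY Y ag; lra.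
Qed.

Lemma shift_path X u s t D v : (u <= s)%N -> (s <= t)%N -> serving X u t ->
  WF u (X u) + (pc X u t + D) <= v ->
  [/\ serving X s t, WF s (X s) + (pc X s t + D) <= v & pc X s t <= pc X u t].
Proof.
move=> us st sX; rewrite (pc_cat X us st) => h.
have h1 : WF s (X s) <= WF u (X u) + pc X u s.
  by apply: WF_path => //; apply: serving_sub sX.
have := pc_ge0 X u s => h2.
by split; [apply: serving_sub sX|lra|lra].
Qed.

(** * Hits, and their sums over nested pieces *)

Definition hit t : R := WF t.+1 (C t) - WF t (C t).

Definition hits s e : R := \sum_(s <= t < e) hit t.

(** Each cut [c] adds one piece and one straddling hit, at time [c.-1]. The induction counts only
    the cuts inside the interval, so both halves can share the list [L]. *)
Lemma hits_cuts L (a b : R) s e : (s <= e)%N -> 0 <= a -> 0 <= b ->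
  (forall t, (s <= t < e)%N -> hit t <= b) ->
  (forall s' e', nocut L s' e' -> (s <= s')%N -> (s' <= e')%N -> (e' <= e)%N ->
     hits s' e' <= a) ->
  hits s e <= a + (a + b) * (size L)%:R.
Proof.
move=> se a0 b0 hb ha.
have [n] := ubnP (e - s).
suff : forall s e, (e - s < n)%N -> (s <= e)%N ->
   (forall t, (s <= t < e)%N -> hit t <= b) ->
   (forall s' e', nocut L s' e' -> (s <= s')%N -> (s' <= e')%N -> (e' <= e)%N ->
     hits s' e' <= a) ->
   hits s e <= a + (a + b) * (count (fun c => (s < c <= e)%N) L)%:R.
  move=> main hn; apply: le_trans (main s e hn se hb ha) _.
  by rewrite lerD2l ler_wpM2l ?addr_ge0 // ler_nat count_size.
elim: n {s e se hb ha} => // n IH s e hn se hb ha.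
have [nc|] := boolP (nocut L s e).
  apply: le_trans (ha s e nc (leqnn _) se (leqnn _)) _.
  by rewrite lerDl mulr_ge0 // addr_ge0.
rewrite -has_predC => /hasP[c cL /=]; rewrite negbK => /andP[sc ce].
case: c => // c in cL sc ce *.
have E : hits s e = hits s c + hit c + hits c.+1 e.
  rewrite /hits (big_cat_nat (m := s) (n := c.+1)) //=; last exact: ltnW.
  by congr (_ + _); rewrite big_nat_recr.
have h1 : hits s c <= a + (a + b) * (count (fun c' => (s < c' <= c)%N) L)%:R.
  apply: IH; [lia|lia| |].
    by move=> t ht; apply: hb; lia.
  by move=> s' e' nc h h' h''; apply: ha => //; lia.
have h2 : hits c.+1 e
    <= a + (a + b) * (count (fun c' => (c.+1 < c' <= e)%N) L)%:R.
  apply: IH; [lia|lia| |].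
    by move=> t ht; apply: hb; lia.
  by move=> s' e' nc h h' h''; apply: ha => //; lia.
have h3 : hit c <= b by apply: hb; lia.
have cnt : (count (fun c' => s < c' <= c) L + count (fun c' => c.+1 < c' <= e) L
    + 1 <= count (fun c' => s < c' <= e) L)%N.
  have cc : (1 <= count (pred1 c.+1) L)%N.
    by rewrite -has_count; apply/hasP; exists c.+1 => //=.
  apply: leq_trans (leq_add (leqnn _) cc) _.
  clear -sc ce; elim: L => //= y L IHL.
  have : ((s < y <= c) + (c.+1 < y <= e) + (y == c.+1) <= (s < y <= e))%N.
    by case: (ltngtP y c.+1) => yc; lia.
  lia.
rewrite E; apply: (@le_trans _ _ (a + (a + b) *
   (count (fun c' => (s < c' <= c)%N) L + count (fun c' => (c.+1 < c' <= e)%N) L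
    + 1)%N%:R)); last by rewrite lerD2l ler_wpM2l ?addr_ge0 // ler_nat.
by rewrite !natrD; lra.
Qed.

(* At [j = 0] both bounds vanish, so that such a piece contains no hit. *)
Definition lev j s e := forall t, (s <= t <= e)%N ->
  (exists X, [/\ serving X s t,
     WF s (X s) + (pc X s t + dist (X t) (C t)) <= WF t (C t)
   & pc X s t + dist (X t) (C t) <= 4 * Wlt j]) /\
  WF e (C t) <= WF t (C t) + 7 * Wlt j.

Lemma hit_lev j s e t : lev j s e -> (s <= t < e)%N -> hit t <= 7 * Wlt j.
Proof.
move=> h /andP[h1 h2]; have [|_ h3] := h t; first by rewrite h1 ltnW.
by have := WF_monoN (C t) h2; rewrite /hit; lra.
Qed.

Definition cheap_path j eta s e t := exists X u, [/\ (u <= s)%N, serving X u t,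
  WF u (X u) + (pc X u t + dist (X t) (C t)) <= WF t (C t)
& servable j u e eta (restr j (X u))].

(** The condition on [eta] turns the bound 3 [Wlt j] + 2 [eta] into the 4 [Wlt j] required by
    [lev]. *)
Lemma lev_of_cheap j eta s e : 2 * eta <= Wlt j ->
  (forall t, (s <= t <= e)%N -> cheap_path j eta s e t) -> lev j s e.
Proof.
move=> heta h t /andP[st te].
have [|X [u [us sX hX g]]] := h t; first by rewrite st.
have ut := leq_trans us st.
have [h1 h2] := cheap_path_bounds ut te g hX.
have [sX' hX' hpc] := shift_path us st sX hX.
split; last by have := Wlt_ge0 j; lra.
by exists X; split=> //; lra.
Qed.

Definition changes j (X : nat -> conf) s t : nat :=
  (\sum_(s <= u < t) (restr j (X u) != restr j (X u.+1)))%N.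

Lemma restr_eq_agree j (A B : conf) : restr j A = restr j B -> agree j A B.
Proof. by move=> /ffunP h i ji; have := h i; rewrite !ffunE ltnNge ji. Qed.

Lemma changes_pc j (i0 : 'I_d) X s t : i0 = j :> nat ->
  (changes j X s t)%:R * w i0 <= pc X s t.
Proof.
move=> ij; rewrite /changes natr_sum mulr_suml; apply: ler_sum => u _.
case: eqP => [_|ne]; first by rewrite mul0r dist_ge0.
rewrite mul1r leNgt; apply/negP => h; apply: ne; apply: restr_agree.
apply: (dge_small w_gt0 k_gt0 w_incr ij); apply: le_lt_trans h.
exact: dge_le_dist.
Qed.

Lemma changes0_agree j X s t : changes j X s t = 0%N ->
  forall u, (s <= u <= t)%N -> agree j (X s) (X u).
Proof.
move=> c0; elim=> [|u IH] /andP[su ut].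
  by have -> : s = 0%N by nlia.
move: su; rewrite leq_eqVlt => /orP[/eqP -> //|su] i ji.
rewrite IH //; last by nlia.
apply: restr_eq_agree ji; apply/eqP; apply: contraTT isT => ne.
move: c0; rewrite /changes (big_cat_nat (m := s) (n := u)) //=; last by nlia.
by rewrite [X in (_ + X)%N]big_ltn // ne; nlia.
Qed.

(* The length of a maximal nested sequence of pieces is limited by the number
   of moves of heavy classes a cheap path can afford. *)
Definition stage j eta s0 b r s e := forall X, serving X s0 s -> pc X s0 s <= b ->
  (r <= changes j X s0 s)%N \/
  exists2 u, (s0 <= u <= s)%N & servable j u e eta (restr j (X u)).

(** Between [s] and [s'] the path either changes a heavy class, which raises the count, or keeps
    them all. In the latter case this stretch serves its heavy part at cost at most
    [K%:R * b <= th], and the choice of [L] keeps that part cheap up to [e']. *)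
Lemma stage_step j th eta s0 b r s e L : (s0 <= s)%N -> K%:R * b <= th ->
  stage j eta s0 b r s e ->
  (forall s' e', nocut L s' e' -> (s <= s')%N -> (e' <= e)%N ->
      forall B, valid k j B -> servable j s s' th B -> servable j s' e' eta B) ->
  forall s' e', nocut L s' e' -> (s <= s')%N -> (e' <= e)%N ->
    stage j eta s0 b r.+1 s' e'.
Proof.
move=> s0s bth st hL s' e' nc ss ee X sX hX.
have hX1 : pc X s0 s <= b.
  by apply: le_trans hX; rewrite (pc_cat X s0s ss) lerDl pc_ge0.
have hX2 : pc X s s' <= b.
  by apply: le_trans hX; rewrite (pc_cat X s0s ss) lerDr pc_ge0.
have [|ch|[u hu g]] := st X _ hX1; first by apply: serving_sub sX.
- have E : changes j X s0 s' = (changes j X s0 s + changes j X s s')%N.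
    by rewrite /changes (big_cat_nat (m := s0) (n := s)).
  case: (posnP (changes j X s s')) => [c0|c1]; last by left; rewrite E; nlia.
  right; exists s'; first by rewrite (leq_trans s0s ss) leqnn.
  have ag := changes0_agree c0.
  have <- : restr j (X s) = restr j (X s').
    by apply: restr_agree; apply: ag; rewrite ss leqnn.
  apply: hL => //; first exact: restr_valid.
  apply: servable_sub bth (path_servable _ ag hX2) => //.
  by apply: serving_sub sX.
- right; exists u; first by nlia.
  by apply: servable_sub g.
Qed.

(** Induction on the number [r] of refinements still to come. Adding [h] makes the bound
    multiplicative: if each piece has hits at most [g], then n cuts give [hits s e + h] at most
    [(g + h)] times n + 1, and n + 1 <= [E]. *)
Lemma stage_hits j s0 e0 (th eta b a h E : R) m r s e : (j <= d)%N ->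
  0 <= th -> 0 < eta -> K%:R * b <= th -> 0 <= a -> 0 <= h -> 1 <= E ->
  ncuts k j th eta <= E - 1 ->
  (forall s e, (s0 <= s)%N -> (s <= e)%N -> (e <= e0)%N ->
     stage j eta s0 b m s e -> hits s e <= a) ->
  (forall t, (s0 <= t < e0)%N -> hit t <= h) ->
  (r <= m)%N -> (s0 <= s)%N -> (s <= e)%N -> (e <= e0)%N ->
  stage j eta s0 b (m - r) s e -> hits s e + h <= E ^+ r * (a + h).
Proof.
move=> jd th0 eta0 bth a0 h0 E1 hE ha hh.
elim: r s e => [|r IH] s e rm s0s se ee0 st.
  by rewrite expr0 mul1r lerD2r; apply: ha => //; rewrite subn0 in st.
have [L sL hL] := @cuts_main R U d k w w_gt0 rq j th eta s e jd th0 eta0.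
pose g := E ^+ r * (a + h) - h.
have Er : 1 <= E ^+ r by rewrite exprn_ege1.
have gh : g + h = E ^+ r * (a + h) by rewrite /g; lra.
have g0 : 0 <= g.
  rewrite /g; have : 0 <= (E ^+ r - 1) * (a + h).
    by rewrite mulr_ge0 ?subr_ge0 ?addr_ge0.
  lra.
have piece s' e' : nocut L s' e' -> (s <= s')%N -> (s' <= e')%N -> (e' <= e)%N ->
    hits s' e' <= g.
  move=> nc ss se' ee; rewrite /g lerBrDr; 
    apply: (IH _ _ (ltnW rm) (leq_trans s0s ss) se' (leq_trans ee ee0)).
  rewrite -(subnSK rm).
  by apply: (stage_step s0s bth st hL).
have hit' t : (s <= t < e)%N -> hit t <= h by move=> ht; apply: hh; nlia.
have := hits_cuts se g0 h0 hit' piece.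
have : (g + h) * (size L)%:R <= (g + h) * (E - 1).
  by apply: ler_wpM2l; [apply: addr_ge0|apply: le_trans hE].
rewrite exprS -mulrA -gh; lra.
Qed.

Lemma Wlt_gt0 j : (0 < j)%N -> (0 < d)%N -> 0 < Wlt j.
Proof.
move=> j0 d0; rewrite /Wlt (bigD1 (Ordinal d0)) //=.
apply: ltr_wpDr; first by apply: sumr_ge0 => i _; apply: wt_ge0.
by rewrite mulr_gt0 // ltr0n.
Qed.

Definition Nk j : R := (nmin k j).+1%:R ^+ K.
Definition Mk j : R := (K.+1 * nmin k j).+1%:R ^+ K.+1.
(** One more than [ncuts k j th eta] for [th / eta = 36 * K%:R ^+ 2], the ratio of the induction
    step. *)
Definition Ek j : R := 1 + (36 * K%:R ^+ 2 * Nk j + 1) * Mk j.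

Lemma Nk_ge0 j : 0 <= Nk j.
Proof. by rewrite exprn_ge0. Qed.

Lemma Mk_ge0 j : 0 <= Mk j.
Proof. by rewrite exprn_ge0. Qed.

Lemma Ek_ge1 j : 1 <= Ek j.
Proof.
by rewrite lerDl mulr_ge0 ?Mk_ge0 // addr_ge0 // !mulr_ge0 ?Nk_ge0 // exprn_ge0.
Qed.

(** * Induction step from level [j] to level [j.+1] *)

Section Step.
Variables (j : nat) (i0 : 'I_d) (kc : R) (s0 e0 : nat).
Hypothesis ij : i0 = j :> nat.
Hypothesis kc0 : 0 <= kc.
Hypothesis IHj : forall s e, (s <= e)%N -> lev j s e -> hits s e <= kc * Wlt j.
Hypothesis lev0 : lev j.+1 s0 e0.

(** [th] bounds [K%:R * b] because [Wlt j.+1 <= K%:R * w i0]. The 9 in [eta] suits both later cases: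
    2 [eta] <= [Wlt j] if [w i0 <= 4 * Wlt j], and 3 [Wlt j] + 2 [eta] < [w i0] otherwise. *)
Let th : R := 4 * K%:R ^+ 2 * w i0.
Let eta : R := w i0 / 9.
Let b : R := 4 * Wlt j.+1.

Let jd : (j < d)%N.
Proof. by rewrite -ij. Qed.

Let Kge1 : 1 <= K%:R :> R.
Proof.
rewrite ler1n /ksum (bigD1 i0) //=; apply: leq_trans (k_gt0 i0) _.
exact: leq_addr.
Qed.

Let WleK : Wlt j.+1 <= K%:R * w i0.
Proof. by rewrite -ij; apply: Wlt_le_w. Qed.

Let wleW : w i0 <= Wlt j.+1.
Proof.
rewrite (WltS _ _ ij); apply: le_trans (w_le_wt w_gt0 k_gt0 i0) _.
by rewrite lerDr Wlt_ge0.
Qed.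

Let WWS : Wlt j <= Wlt j.+1.
Proof. by rewrite (WltS _ _ ij) lerDl wt_ge0. Qed.

Let th_ge0 : 0 <= th.
Proof. by rewrite !mulr_ge0 ?exprn_ge0 // ltW. Qed.

Let eta_gt0 : 0 < eta.
Proof. by rewrite divr_gt0. Qed.

Let bth : K%:R * b <= th.
Proof.
rewrite /b /th expr2 mulrCA -!mulrA; do 2 rewrite ler_wpM2l //.
Qed.

Let eta_th : eta <= th.
Proof.
rewrite /eta /th; have : 1 <= K%:R ^+ 2 :> R by rewrite exprn_ege1.
by move: (K%:R ^+ 2) => x x1; have := w_gt0 i0; nra.
Qed.

(** A path of cost at most [b <= 4 * K%:R * w i0] cannot afford [4 * K + 1] changes of heavy
    classes, so the second alternative of [stage] holds. *)
Lemma stage_cheap s e t : (s0 <= s)%N -> (e <= e0)%N ->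
  stage j eta s0 b (4 * K + 1) s e -> (s <= t <= e)%N -> cheap_path j eta s e t.
Proof.
move=> s0s ee0 st /andP[s1 s2].
have [|[X [sX hX cX]] _] := lev0 (t := t); first by nlia.
have s0t := leq_trans s0s s1.
have pX : pc X s0 s <= b.
  apply: le_trans cX; rewrite (pc_cat X s0s s1) -addrA lerDl.
  by rewrite addr_ge0 ?pc_ge0.
have [|ch|[u /andP[u1 u2] g]] := st X _ pX; first by apply: serving_sub sX.
  have := changes_pc X s0 s ij; have w0 := w_gt0 i0.
  have : (4 * K + 1)%N%:R * w i0 <= (changes j X s0 s)%:R * w i0.
    by rewrite ler_wpM2r ?ler_nat // ltW.
  rewrite natrD natrM; move: pX WleK; rewrite /b; lra.
have [sX' hX' _] := shift_path u1 (leq_trans u2 s1) sX hX.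
by exists X, u.
Qed.

(** If [w i0 <= 4 * Wlt j], the cheap paths already give [lev j]. Otherwise they never move a class
    from [j] on, and a finer cutting with tolerance [Wlt j / 2] yields [lev j]; its cuts may be
    many, but each costs a multiple of [Wlt j] only, in total a multiple of [w i0]. *)
Lemma stage_mid_hits s e : (s0 <= s)%N -> (s <= e)%N -> (e <= e0)%N ->
  stage j eta s0 b (4 * K + 1) s e -> hits s e <= (kc + 2) * Ek j * Wlt j.+1.
Proof.
move=> s0s se ee0 st.
have cp t := @stage_cheap s e t s0s ee0 st.
have w0 := w_gt0 i0; have W0 := Wlt_ge0 j; have E1 := Ek_ge1 j.
have direct : lev j s e -> hits s e <= (kc + 2) * Ek j * Wlt j.+1.
  move=> /(IHj se) /le_trans; apply; apply: ler_pM => //.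
  by rewrite -[X in X <= _]mulr1; apply: ler_pM => //; lra.
have [j0|jpos] := posnP j.
  apply: direct; apply: (@lev_of_cheap _ 0); first by rewrite mulr0.
  move=> t /cp [X [u [h1 h2 h3 h4]]]; exists X, u; split=> //.
  by move: h4; rewrite j0; apply: servable_level0.
have [wsmall|wbig] := leP (w i0) (4 * Wlt j).
  apply: direct; apply: (@lev_of_cheap _ eta) => //; rewrite /eta; lra.
have Wpos : 0 < Wlt j by apply: Wlt_gt0 => //; nlia.
have cst t : (s <= t <= e)%N -> exists X u, [/\ (u <= s)%N, serving X u t,
    WF u (X u) + (pc X u t + dist (X t) (C t)) <= WF t (C t),
    servable j u e eta (restr j (C t))
  & forall v, (u <= v <= t)%N -> restr j (X v) = restr j (C t)].
  move=> ht; have [X [u [us sX hX g]]] := cp t ht.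
  have ut : (u <= t)%N by nlia.
  have te : (t <= e)%N by nlia.
  have [h1 _] := cheap_path_bounds ut te g hX.
  have small : pc X u t + dist (X t) (C t) < w i0.
    by apply: le_lt_trans h1 _; rewrite /eta; lra.
  have agC : restr j (X u) = restr j (C t).
    apply: restr_agree; apply: (dge_small w_gt0 k_gt0 w_incr ij).
    apply: le_lt_trans small.
    apply: le_trans (@dge_triangle R U d k w w_gt0 j _ (X t) _) _.
    by rewrite lerD ?dge_pc //; apply: dge_le_dist.
  exists X, u; split=> //; first by rewrite -agC.
  move=> v /andP[uv vt]; rewrite -agC; apply: restr_agree => i ji; apply/esym.
  apply: (dge_small w_gt0 k_gt0 w_incr ij) ji; apply: le_lt_trans small.
  apply: le_trans (dge_pc j X uv) _; rewrite (pc_cat X uv vt).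
  by rewrite -addrA lerDl addr_ge0 ?pc_ge0.
have hit2 t : (s <= t < e)%N -> hit t <= 2 * Wlt j.
  move=> ht; have [|X [u [us _ _ g _]]] := cst t; first by nlia.
  (* The request can be served with the heavy classes of [C t] in place: [Wlt j] to go there and
     [Wlt j] to return. *)
  have g1 : servable j t t.+1 0 (restr j (C t)).
    by apply: (servable_single (th := eta)); apply: servable_sub g => //; nlia.
  have [Y ag hY] := cheap_WF (leqnSn t) (leqnn _) g1.
  have h1 := WF_lip t.+1 Y (C t); have h2 := dist_agree w_gt0 ag.
  by rewrite /hit; rewrite distC in h2; lra.
have eta'0 : 0 < Wlt j / 2 by rewrite divr_gt0.
have [L sL hL] := @cuts_main R U d k w w_gt0 rq j th (Wlt j / 2) s e (ltnW jd) th_ge0 eta'0.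
have piece s' e' : nocut L s' e' -> (s <= s')%N -> (s' <= e')%N -> (e' <= e)%N ->
    hits s' e' <= kc * Wlt j.
  move=> nc ss se' ee; apply: IHj => //.
  apply: (@lev_of_cheap _ (Wlt j / 2)); first lra.
  move=> t ht; have [|X [u [us sX hX g cX]]] := cst t; first by nlia.
  have us' := leq_trans us ss.
  have s't : (s' <= t)%N by nlia.
  have [sX' hX' _] := shift_path us' s't sX hX.
  exists X, s'; split=> //; apply: hL => //; first exact: restr_valid.
  rewrite cX; last by nlia.
  by apply: servable_sub eta_th g => //; nlia.
have kW : 0 <= kc * Wlt j by rewrite mulr_ge0.
have W2 : 0 <= 2 * Wlt j by lra.
apply: le_trans (hits_cuts se kW W2 hit2 piece) _.
(* The factor [Wlt j] cancels the denominator in [th / (Wlt j / 2)]. *)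
have sW : Wlt j * (size L)%:R <= (8 * K%:R ^+ 2 * Nk j + 1) * Mk j * w i0.
  apply: (@le_trans _ _ (Wlt j * ncuts k j th (Wlt j / 2))).
    by rewrite ler_wpM2l.
  have -> : Wlt j * ncuts k j th (Wlt j / 2)
      = (2 * (th * Nk j) + Wlt j) * Mk j.
    rewrite /ncuts /thr subn0 -/(Nk j) -/(Mk j).
    by field; rewrite gt_eqF.
  rewrite [X in _ <= X]mulrAC; apply: ler_wpM2r; first exact: Mk_ge0.
  rewrite /th; lra.
have M0 := Mk_ge0 j; have N0 := Nk_ge0 j.
apply: (@le_trans _ _ ((kc + 2) * (Wlt j + Wlt j * (size L)%:R))).
  have : 0 <= Wlt j by [].
  lra.
rewrite -mulrA ler_wpM2l ?addr_ge0 //.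
apply: (@le_trans _ _ (Ek j * w i0)); last by rewrite ler_wpM2l // (le_trans _ E1).
rewrite /Ek mulrDl mul1r; apply: lerD; first lra.
apply: le_trans sW _; rewrite ler_wpM2r ?(ltW w0) // ler_wpM2r // lerD2r.
by rewrite ler_wpM2r // ler_wpM2r ?exprn_ge0 // ler_nat.
Qed.

(** Refine [4 * K + 1] times, starting from the trivial stage 0 on the whole interval; [1 <= Ek j]
    absorbs the additive 7. *)
Lemma level_step : (s0 <= e0)%N ->
  hits s0 e0 <= Ek j ^+ (4 * K + 2) * (kc + 9) * Wlt j.+1.
Proof.
move=> se; have E1 := Ek_ge1 j; have W0 := Wlt_ge0 j.+1.
have E0 : 0 <= Ek j by apply: le_trans E1.
have w0 := w_gt0 i0.
have a0 : 0 <= (kc + 2) * Ek j * Wlt j.+1 by rewrite !mulr_ge0 // addr_ge0.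
have h0 : 0 <= 7 * Wlt j.+1 by lra.
have nc : ncuts k j th eta <= Ek j - 1.
  rewrite /Ek addrAC subrr add0r /ncuts /thr subn0 -/(Nk j) -/(Mk j).
  rewrite ler_wpM2r ?Mk_ge0 // lerD2r /th /eta le_eqVlt; apply/orP; left.
  by apply/eqP; field; rewrite gt_eqF.
have hh t : (s0 <= t < e0)%N -> hit t <= 7 * Wlt j.+1.
  by move=> ht; apply: (hit_lev lev0).
have st0 : stage j eta s0 b (4 * K + 1 - (4 * K + 1)) s0 e0.
  by rewrite subnn => X _ _; left.
have := stage_hits (ltnW jd) th_ge0 eta_gt0 bth a0 h0 E1 nc stage_mid_hits hh
  (leqnn _) (leqnn s0) se (leqnn _) st0.
move=> H; have {H} : hits s0 e0 <= Ek j ^+ (4 * K + 1) *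
    ((kc + 2) * Ek j * Wlt j.+1 + 7 * Wlt j.+1) by lra.
move=> /le_trans; apply.
have -> : (4 * K + 2 = (4 * K + 1).+1)%N by rewrite addnS.
rewrite exprSr -!mulrA ler_wpM2l ?exprn_ge0 //.
rewrite !mulrA -mulrDl ler_wpM2r //.
have := mulr_ge0 kc0 E0; lra.
Qed.

End Step.

Fixpoint Kc (j : nat) : R :=
  if j is j'.+1 then Ek j' ^+ (4 * K + 2) * (Kc j' + 9) else 0.

Lemma Kc_ge0 j : 0 <= Kc j.
Proof.
elim: j => //= j IH; rewrite mulr_ge0 ?addr_ge0 // exprn_ge0 //.
exact: le_trans (Ek_ge1 j).
Qed.

Lemma level_hits j s e : (j <= d)%N -> (s <= e)%N -> lev j s e ->
  hits s e <= Kc j * Wlt j.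
Proof.
elim: j s e => [|j IH] s e jd se hl.
  rewrite mul0r /hits big_nat; apply: sumr_le0 => t ht.
  by have := hit_lev hl ht; rewrite Wlt0 mulr0.
apply: (@level_step j (Ordinal jd)) => //; first exact: Kc_ge0.
by move=> s' e'; apply: IH; apply: ltnW.
Qed.

(** * Phases of the minimum of the work function, and the total cost *)

Variable Y : nat -> conf.
Hypothesis Y_min : forall t X, WF t (Y t) <= WF t X.

Lemma WFmin_mono s t : (s <= t)%N -> WF s (Y s) <= WF t (Y t).
Proof. by move=> st; apply: le_trans (Y_min _ _) _; apply: WF_monoN. Qed.

(** [Wlt d] bounds the diameter, so [C t] lies at most half of it above the minimum, and an optimal
    path to [C t] costs at most 3/2 [Wlt d] within the phase. *)
Lemma phase_lev s e : WF e (Y e) <= WF s (Y s) + Wlt d -> lev d s e.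
Proof.
move=> he t /andP[st te].
have hst := WFmin_mono st; have hte := WFmin_mono te.
have W0 := Wlt_ge0 d.
have v1 : WF t (C t) <= WF t (Y t) + 1 / 2 * Wlt d.
  have := alg_min t (Y t); have := dist_le_all w_gt0 (Y t) (C t); lra.
split; last first.
  have h1 := WF_lip e (Y e) (C t); have h2 := dist_le_all w_gt0 (Y e) (C t).
  have h3 := Y_min t (C t); lra.
have [X sX hX] := WF_opt (C t) st; exists X; split=> //.
have := Y_min s (X s); lra.
Qed.

Lemma hit_all t : hit t <= 2 * Wlt d.
Proof.
have [X sX _] := WF_att t (C t).
have h1 := WF_le (C t) sX; have h2 := WF_lip t (C t) X.
have h3 := dist_le_all w_gt0 X (C t); have h4 := dist_le_all w_gt0 (C t) X.
rewrite /hit; lra.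
Qed.

(** A phase ends when the minimum has grown by more than [Wlt d]. This growth pays for the phase and
    its closing hit; the additive [Wlt d] pays for the last one. *)
Lemma total_hits s T : (s <= T)%N ->
  hits s T <= (Kc d + 2) * (Wlt d + (WF T (Y T) - WF s (Y s))).
Proof.
have K0 := Kc_ge0 d; have W0 := Wlt_ge0 d.
have [n] := ubnP (T - s); elim: n s => // n IH s hn sT.
have [one|more] := leP (WF T (Y T)) (WF s (Y s) + Wlt d).
  apply: le_trans (level_hits (leqnn d) sT (phase_lev one)) _.
  have := WFmin_mono sT => hm.
  have := mulr_ge0 K0 W0; have : 0 <= Kc d * (WF T (Y T) - WF s (Y s)).
    by rewrite mulr_ge0 // subr_ge0.
  lra.
have ex : exists t, (s <= t)%N && (WF s (Y s) + Wlt d < WF t (Y t)).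
  by exists T; rewrite sT.
case: (ex_minnP ex) => e1 /andP[se1 big1] min1.
have se1' : (s < e1)%N.
  rewrite ltn_neqAle se1 andbT; apply/eqP => E; move: big1.
  by rewrite -E ltNge lerDl W0.
have e1T : (e1 <= T)%N by apply: min1; rewrite sT.
case: e1 => // e in se1 big1 min1 se1' e1T *.
have small : WF e (Y e) <= WF s (Y s) + Wlt d.
  rewrite leNgt; apply/negP => bad.
  by have := min1 e; rewrite bad andbT => /(_ se1'); rewrite ltnn.
have se : (s <= e)%N by rewrite -ltnS.
have h1 := level_hits (leqnn d) se (phase_lev small).
have h2 := hit_all e.
have h3 : hits e.+1 T <= (Kc d + 2) * (Wlt d + (WF T (Y T) - WF e.+1 (Y e.+1))).
  by apply: IH => //; nlia.
have -> : hits s T = hits s e + hit e + hits e.+1 T.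
  rewrite /hits (big_cat_nat (m := s) (n := e.+1)) //=.
  by rewrite big_nat_recr.
have : 0 <= (Kc d + 2) * (WF e.+1 (Y e.+1) - WF s (Y s) - Wlt d).
  by apply: mulr_ge0; [exact: addr_ge0|lra].
lra.
Qed.

Hypothesis alg_step : forall t,
  WF t.+1 (C t.+1) + 1 / 2 * dist (C t.+1) (C t) <= WF t.+1 (C t).

(** Half of each movement is at most the drop of [WF t.+1] from [C t] to [C t.+1]; the drops sum to
    the hits plus a telescoping difference. *)
Lemma alg_total T : 0 <= WF T (C T) ->
  pc C 0 T <= 2 * (WF 0 (C 0) + (Kc d + 2) * (Wlt d + (WF T (Y T) - WF 0 (Y 0)))).
Proof.
move=> vT; have h := total_hits (leq0n T).
suff : pc C 0 T <= 2 * (WF 0 (C 0) - WF T (C T) + hits 0 T) by lra.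
elim: T {vT h} => [|T IH].
  by rewrite /pc /hits !big_geq // addr0 subrr mulr0.
rewrite (pc_cat C (leq0n T)) // [X in _ + X]/pc big_nat1.
rewrite /hits big_nat_recr //= -/(hits 0 T) /hit.
have := alg_step T; rewrite (distC _ (C T.+1)); lra.
Qed.

End WorkFunction.

(** * Numerical bounds on the constants *)

Section Constants.
Variables (R : realType) (d : nat) (k : 'I_d -> nat).
Hypothesis d_gt0 : (0 < d)%N.
Hypothesis k_gt0 : forall i, (0 < k i)%N.

Local Notation K := (ksum k).

Lemma ksum_gt0 : (0 < K)%N.
Proof.
rewrite /ksum (bigD1 (Ordinal d_gt0)) //=.
exact: leq_trans (k_gt0 _) (leq_addr _ _).
Qed.

Lemma leq_exp2S a b : (0 < b)%N -> (2 ^ a + 1 <= 2 ^ (a + b))%N.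
Proof.
move=> b0; rewrite expnD; have a1 : (0 < 2 ^ a)%N by rewrite expn_gt0.
have b2 : (2 <= 2 ^ b)%N by rewrite -{1}(expn1 2) leq_pexp2l.
by apply: leq_trans (leq_mul (leqnn _) b2); rewrite muln2 -addnn leq_add2l.
Qed.

Lemma Ek_le j : Ek R k j <= 2 ^+ (18 * (d * K * kprod k j) * K).
Proof.
set L := (d * K * kprod k j)%N.
have K1 := ksum_gt0.
have KL : (K <= L)%N.
  by rewrite /L mulnAC leq_pmull // muln_gt0 d_gt0 kprod_gt0.
have L1 : (0 < L)%N by apply: leq_trans KL.
have LK1 : (0 < L * K)%N by rewrite muln_gt0 L1.
have nE : nmin k j = (2 ^ L)%N by rewrite /nmin -expnM /L mulnAC.
have K2 : (K.+1 <= 2 ^ K)%N by apply: ltn_expl.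
have pN : ((nmin k j).+1 ^ K <= 2 ^ (2 * (L * K)))%N.
  rewrite mulnA expnM; rewrite leq_exp2r //.
  by rewrite nE -addn1 mul2n -addnn; apply: leq_exp2S.
have pM : ((K.+1 * nmin k j).+1 ^ K.+1 <= 2 ^ (6 * (L * K)))%N.
  have h1 : ((K.+1 * nmin k j).+1 <= 2 ^ (3 * L))%N.
    apply: (@leq_trans (2 ^ (2 * L) + 1)).
      rewrite addn1 ltnS nE mul2n -addnn expnD leq_mul //.
      by apply: leq_trans K2 _; rewrite leq_exp2l.
    have -> : (3 * L = 2 * L + L)%N by rewrite -mulSnr.
    exact: leq_exp2S.
  apply: (@leq_trans ((2 ^ (3 * L)) ^ K.+1)); first by rewrite leq_exp2r.
  rewrite -expnM leq_exp2l //.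
  by rewrite -(mulnA 3) -[6%N]/(3 * 2)%N -mulnA leq_mul2l /= mulnCA leq_mul //; lia.
have E : (1 + (36 * K ^ 2 * (nmin k j).+1 ^ K + 1) * (K.+1 * nmin k j).+1 ^ K.+1
    <= 2 ^ (18 * L * K))%N.
  have h36 : (36 <= 2 ^ (6 * (L * K)))%N.
    by apply: (@leq_trans (2 ^ 6)) => //; rewrite leq_exp2l // leq_pmulr.
  have hK2 : (K ^ 2 <= 2 ^ (2 * (L * K)))%N.
    rewrite mulnC expnM; rewrite leq_exp2r //; apply: ltnW.
    apply: leq_trans K2 _; rewrite leq_exp2l //; exact: leq_pmull.
  have h1 : (36 * K ^ 2 * (nmin k j).+1 ^ K + 1 <= 2 ^ (11 * (L * K)))%N.
    have -> : (11 * (L * K) = (6 * (L * K) + 2 * (L * K) + 2 * (L * K)) + L * K)%N.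
      by rewrite -!mulnDl -mulSnr.
    apply: leq_trans (leq_exp2S _ LK1); rewrite leq_add2r 2!expnD.
    by rewrite !leq_mul.
  have -> : (18 * L * K = (11 * (L * K) + 6 * (L * K)) + L * K)%N.
    by rewrite -mulnA -mulnDl -mulSnr.
  rewrite addnC; apply: leq_trans (leq_exp2S _ LK1).
  by rewrite leq_add2r expnD leq_mul.
rewrite -(ler_nat R) in E; apply: le_trans _ (le_trans E _); last by rewrite natrX.
by rewrite natrD natrM natrD !natrM !natrX.
Qed.

(** With the shift by 9 the recursion is a product up to a factor 2. The exponent Z at least doubles
    from one level to the next, so 1 + 108 Z + 109 Z fits into 109 times its new value. *)
Lemma Kc_le j : (j <= d)%N ->
  Kc R k j + 9 <= 2 ^+ (4 + 109 * (d * K ^ 3 * kprod k j)).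
Proof.
have K1 := ksum_gt0.
elim: j => [|j IH] jd.
  rewrite /= add0r; apply: (@le_trans _ _ (2 ^+ 4)).
    by rewrite -natrX ler_nat.
  by rewrite ler_weXn2l ?ler1n // leq_addr.
rewrite (@kprodS _ k j (Ordinal jd)) //=; set i0 := Ordinal jd.
set Z := (d * K ^ 3 * kprod k j)%N in IH *.
have Z1 : (0 < Z)%N by rewrite !muln_gt0 d_gt0 K1 kprod_gt0.
have E1 : Ek R k j ^+ (4 * K + 2) <= 2 ^+ (108 * Z).
  have e0 : 0 <= Ek R k j by apply: le_trans (Ek_ge1 R k j).
  apply: (@le_trans _ _ ((2 ^+ (18 * (d * K * kprod k j) * K)) ^+ (4 * K + 2))).
    by rewrite lerXn2r // ?nnegrE ?exprn_ge0 // Ek_le.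
  rewrite -exprM ler_weXn2l ?ler1n //.
  have -> : (108 * Z = 18 * (d * K * kprod k j) * K * (6 * K))%N.
    by rewrite /Z; ring.
  by rewrite leq_mul2l; apply/orP; right; lia.
have kc0 := Kc_ge0 R k j.
have IH' := IH (ltnW jd).
have EE1 : 1 <= Ek R k j ^+ (4 * K + 2) by rewrite exprn_ege1 // Ek_ge1.
apply: (@le_trans _ _ (2 * (Ek R k j ^+ (4 * K + 2) * (Kc R k j + 9)))).
  have c9 : 0 <= Kc R k j + 9 by apply: addr_ge0.
  rewrite mulr2n mulrDl mul1r lerD2l -[X in X <= _]mul1r; apply: ler_pM => //.
  by rewrite lerDr.
apply: (@le_trans _ _ (2 * (2 ^+ (108 * Z) * 2 ^+ (4 + 109 * Z)))).
  rewrite ler_wpM2l // ler_pM // ?addr_ge0 // exprn_ge0 //.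
  exact: le_trans (Ek_ge1 R k j).
rewrite -exprD -exprS ler_weXn2l ?ler1n //.
have : (2 * Z <= d * K ^ 3 * (kprod k j * (k i0).+1))%N.
  by rewrite mulnA -/Z mulnC leq_mul2l ltnS k_gt0 orbT.
move: (d * K ^ 3 * (kprod k j * (k i0).+1))%N => Z'; clear -Z1; lia.
Qed.

Lemma ratio_le : 2 * (Kc R k d + 2) * K%:R
  <= 2 `^ (115 * d%:R * (\sum_(i < d) k i)%:R ^+ 3
           * \prod_(i < d) ((k i)%:R + 1)).
Proof.
have K1 := ksum_gt0.
have -> : 115 * d%:R * (\sum_(i < d) k i)%:R ^+ 3 * \prod_(i < d) ((k i)%:R + 1)
    = (115 * (d * K ^ 3 * kprod k d))%:R :> R.
  rewrite natrM natrM natrM natrX !mulrA; congr (_ * _).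
  rewrite /kprod natr_prod [in RHS](eq_bigl xpredT); last first.
    by move=> i; rewrite ltn_ord.
  by apply: eq_bigr => i _; rewrite natr1.
rewrite powR_mulrn //; have h := Kc_le (leqnn d).
set Z := (d * K ^ 3 * kprod k d)%N in h *.
have KZ : (K <= Z)%N.
  rewrite /Z mulnAC [(_ ^ 3)%N]expnS mulnCA leq_pmulr //.
  by rewrite !muln_gt0 d_gt0 kprod_gt0 K1.
have kc0 := Kc_ge0 R k d.
(* 115 = 109 + 6, and 6 Z covers the remaining 5 + [K] since [1 <= K <= Z]. *)
apply: (@le_trans _ _ (2 * 2 ^+ (4 + 109 * Z) * 2 ^+ K)).
  apply: ler_pM => //.
  - by rewrite mulr_ge0 // addr_ge0.
  - by rewrite ler_wpM2l // (le_trans _ h) // lerD2l ler_nat.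
  - by rewrite -natrX ler_nat ltnW // ltn_expl.
rewrite -exprS -exprD ler_weXn2l ?ler1n //; clear -KZ K1; lia.
Qed.

End Constants.

(** * Paths given as sequences of configurations *)

Section Paths.
Variables (R : realType) (U : finType) (d : nat) (k : 'I_d -> nat).
Local Notation conf := (config U k).

Lemma path_cost_rcons (dist : conf -> conf -> R) X cs Y :
  path_cost dist X (rcons cs Y) = path_cost dist X cs + dist (last X cs) Y.
Proof.
elim: cs X => [|Z cs IH] X /=; first by rewrite addr0 add0r.
by rewrite IH addrA.
Qed.

Lemma path_cost_mkseq (dist : conf -> conf -> R) (X : nat -> conf) n :
  path_cost dist (X 0%N) (mkseq (fun t => X t.+1) n)
  = \sum_(0 <= u < n) dist (X u) (X u.+1).
Proof.
elim: n => [|n IH]; first by rewrite big_geq.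
rewrite mkseqS path_cost_rcons IH big_nat_recr //=; congr (_ + dist _ _).
by case: n {IH} => // n; rewrite mkseqS last_rcons.
Qed.

Lemma all2_rcons (S T : Type) (r : S -> T -> bool) s x t y :
  all2 r (rcons s x) (rcons t y) = all2 r s t && r x y.
Proof.
elim: s t => [|a s IH] [|b t] //=; rewrite ?andbT ?IH ?andbA //.
- by case: t => [|c t] /=; rewrite andbF.
- by case: s {IH} => [|c s] /=; rewrite ?andbF.
Qed.

Lemma all2_rconsl (S T : Type) (r : S -> T -> bool) s x cs :
  all2 r (rcons s x) cs ->
  exists cs' y, [/\ cs = rcons cs' y, all2 r s cs' & r x y].
Proof.
case/lastP: cs => [|cs y]; first by case: s.
by rewrite all2_rcons => /andP[h1 h2]; exists cs, y.
Qed.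

Lemma fin_min (I : finType) (P : pred I) (F : I -> R) i0 : P i0 ->
  exists2 i, P i & forall i', P i' -> F i <= F i'.
Proof. by move=> P0; case: (arg_minP F P0) => i Pi h; exists i. Qed.

Lemma all2_size (S T : Type) (r : S -> T -> bool) s t :
  all2 r s t -> size t = size s.
Proof. by elim: s t => [|a s IH] [|b t] //= /andP[_ /IH ->]. Qed.

End Paths.

(** * The actual work function and WFA satisfy the abstract hypotheses *)

Section Instance.
Variables (R : realType) (U : finType) (d : nat) (k : 'I_d -> nat).
Variable w : 'I_d -> R.
Hypothesis d_gt0 : (0 < d)%N.
Hypothesis w_gt0 : forall i, 0 < w i.
Hypothesis k_gt0 : forall i, (0 < k i)%N.
Hypothesis w_incr : forall i j : 'I_d, (i < j)%N -> w i < w j.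
Variables (C0 : config U k) (A : online_alg U k).

Local Notation conf := (config U k).
Local Notation dist := (@conf_dist R U d k w).
Local Notation K := (ksum k).
Local Notation wf := (work_fun w C0).

Lemma serves_exists x : exists X : conf, serves x X.
Proof.
have [f [f1 _]] := conf_extend C0.
pose i0 := Ordinal d_gt0.
pose T : tup U d := [ffun i => if i == i0 then [set x] else set0].
have hT i : (#|T i| <= k i)%N.
  by rewrite ffunE; case: ifP => _; rewrite ?cards1 ?cards0.
exists (f T); apply/bigcupP; exists i0 => //.
by apply: (subsetP (f1 T hT i0)); rewrite ffunE eqxx set11.
Qed.

Lemma schedule_exists sigma : exists cs : seq conf, all2 (@serves _ _ _) sigma cs.
Proof.
elim: sigma => [|x s [cs h]]; first by exists [::].
by have [X hX] := serves_exists x; exists (X :: cs); rewrite /= hX.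
Qed.

Lemma path_cost_ge0 (X : conf) cs : 0 <= path_cost dist X cs.
Proof.
by elim: cs X => //= Y cs IH X; rewrite addr_ge0 // dist_ge0.
Qed.

Lemma wf_le sigma cs X : all2 (@serves _ _ _) sigma cs ->
  wf sigma X <= path_cost dist C0 cs + dist (last C0 cs) X.
Proof.
move=> h; apply: ge_inf; last by exists cs.
by exists 0 => _ [cs' _ <-]; rewrite addr_ge0 ?path_cost_ge0 ?dist_ge0.
Qed.

(** Schedules have the length of [sigma], so they range over a finite type of tuples and the infimum
    is attained. *)
Lemma wf_att sigma X : exists2 cs, all2 (@serves _ _ _) sigma cs
  & path_cost dist C0 cs + dist (last C0 cs) X = wf sigma X.
Proof.
have [cs0 h0] := schedule_exists sigma.
pose F (cs : seq conf) := path_cost dist C0 cs + dist (last C0 cs) X.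
have st0 : size cs0 == size sigma by rewrite (all2_size h0).
have [cs hcs min] := @fin_min R ((size sigma).-tuple conf)
  (fun cs => all2 (@serves _ _ _) sigma cs) (fun cs => F cs) (Tuple st0) h0.
exists (val cs) => //; apply/eqP; rewrite eq_le wf_le // andbT.
apply: lb_le_inf; first by exists (F cs), (val cs).
move=> _ [cs' hcs' <-]; have st' : size cs' == size sigma.
  by rewrite (all2_size hcs').
exact: (min (Tuple st')).
Qed.

Lemma wf_step_le sigma x X Y : serves x X ->
  wf (rcons sigma x) Y <= wf sigma X + dist X Y.
Proof.
move=> sX; have [cs h <-] := wf_att sigma X.
have h' : all2 (@serves _ _ _) (rcons sigma x) (rcons cs X).
  by rewrite all2_rcons h.
by apply: le_trans (wf_le Y h') _; rewrite path_cost_rcons last_rcons.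
Qed.

Lemma wf_step_att sigma x Y : exists2 X, serves x X
  & wf sigma X + dist X Y <= wf (rcons sigma x) Y.
Proof.
have [cs h <-] := wf_att (rcons sigma x) Y.
have [cs' [X [-> h1 h2]]] := all2_rconsl h.
by exists X => //; rewrite path_cost_rcons last_rcons lerD2r wf_le.
Qed.

Lemma wf_lip sigma X Y : wf sigma Y <= wf sigma X + dist X Y.
Proof.
have [cs h <-] := wf_att sigma X; apply: le_trans (wf_le Y h) _.
by rewrite -addrA lerD2l; apply: dist_triangle.
Qed.

Lemma wf_ge0 sigma X : 0 <= wf sigma X.
Proof.
by have [cs h <-] := wf_att sigma X; rewrite addr_ge0 ?path_cost_ge0 ?dist_ge0.
Qed.

Lemma move_le_dist (X Y : conf) : move_cost w X Y <= dist X Y.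
Proof.
apply: ler_sum => i _; case: (eqVneq (servers X i) (servers Y i)) => [->|ne].
  by rewrite setDv cards0 !mulr0.
rewrite mulr1 mulrC ler_wpM2r ?(ltW (w_gt0 i)) // ler_nat.
by rewrite -(card_servers Y i); apply: subset_leq_card; apply: subsetDl.
Qed.

(** By equal cardinality a changed class moves at least one server; charging all [k i] of them loses
    at most the factor [K]. *)
Lemma dist_le_move (X Y : conf) : dist X Y <= K%:R * move_cost w X Y.
Proof.
rewrite /move_cost mulr_sumr; apply: ler_sum => i _.
case: (eqVneq (servers X i) (servers Y i)) => [->|ne].
  by rewrite setDv cards0 !mulr0.
rewrite mulr1 mulrA -[X in X <= _]mulr1; apply: ler_pM => //.
- by rewrite mulr_ge0 // ltW.
- rewrite ler_wpM2r ?(ltW (w_gt0 i)) // ler_nat /ksum (bigD1 i) //=.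
  exact: leq_addr.
- rewrite ler1n card_gt0; apply: contra ne => /eqP D0.
  rewrite eq_sym eqEcard !card_servers leqnn andbT.
  by apply/subsetP => x xY; apply: contraT => xX;
    have := in_set0 x; rewrite -D0 inE xX xY.
Qed.

Lemma wf_le_opt sigma (Y : conf) : (forall X, wf sigma Y <= wf sigma X) ->
  wf sigma Y <= K%:R * opt_cost w C0 sigma.
Proof.
move=> hY; have K1 := ksum_gt0 d_gt0 k_gt0.
rewrite mulrC -ler_pdivrMr ?ltr0n //.
have [cs0 h0] := schedule_exists sigma.
apply: lb_le_inf; first by exists (path_cost (@move_cost R U d k w) C0 cs0), cs0.
move=> _ [cs h <-]; rewrite ler_pdivrMr ?ltr0n //.
apply: le_trans (hY (last C0 cs)) _; apply: le_trans (wf_le _ h) _.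
rewrite distxx addr0 mulrC; elim: cs (C0) {h} => [|X cs IH] Z /=.
  by rewrite mulr0.
by rewrite mulrDr lerD // dist_le_move.
Qed.

Lemma opt_ge0 sigma : 0 <= opt_cost w C0 sigma.
Proof.
have [cs0 h0] := schedule_exists sigma.
apply: lb_le_inf; first by exists (path_cost (@move_cost R U d k w) C0 cs0), cs0.
move=> _ [cs _ <-]; elim: cs (C0) => //= X cs IH Z; rewrite addr_ge0 //.
by apply: sumr_ge0 => i _; rewrite mulr_ge0 // ltW.
Qed.

Hypothesis A_wfa : is_WFA w (1 / 2) C0 A.

Lemma wf_nil : wf [::] C0 = 0.
Proof.
apply/eqP; rewrite eq_le wf_ge0 andbT.
by apply: le_trans (@wf_le [::] [::] C0 isT) _; rewrite /= add0r distxx.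
Qed.

(** The algorithm minimises relative to its previous position; the triangle inequality through the
    new position replaces the former by the latter. *)
Lemma wfa_min sigma X : wf sigma (A sigma) <= wf sigma X + 1 / 2 * dist X (A sigma).
Proof.
have [A0 A1] := A_wfa; case/lastP: sigma => [|s x].
  rewrite A0 wf_nil addr_ge0 ?wf_ge0 // mulr_ge0 ?divr_ge0 // dist_ge0 //.
have /= := A1 s x X.
have := dist_triangle w_gt0 X (A (rcons s x)) (A s); lra.
Qed.

Lemma wfa_step sigma x : wf (rcons sigma x) (A (rcons sigma x))
  + 1 / 2 * dist (A (rcons sigma x)) (A sigma) <= wf (rcons sigma x) (A sigma).
Proof.
have [_ A1] := A_wfa; have /= := A1 sigma x (A sigma).
by rewrite distxx mulr0 addr0.
Qed.

(** The value at the new position is attained through some [X] serving [x]; as 1/2 < 1, minimality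
    forces the distance to [X] to vanish. *)
Lemma wfa_serves sigma x : serves x (A (rcons sigma x)).
Proof.
have [X sX h1] := wf_step_att sigma x (A (rcons sigma x)).
have h2 := wf_step_le sigma X sX; rewrite distxx addr0 in h2.
have h3 := wfa_min (rcons sigma x) X.
have <- // : X = A (rcons sigma x).
by apply: (dist_eq0 w_gt0 k_gt0); lra.
Qed.

Lemma trajectory_mkseq (rq : nat -> U) n :
  trajectory A (mkseq rq n) = mkseq (fun t => A (mkseq rq t.+1)) n.
Proof.
rewrite /trajectory size_mkseq; apply/eq_in_map => t.
rewrite mem_iota add0n => /andP[_ tn]; congr A.
by rewrite /mkseq -map_take take_iota (minn_idPl tn).
Qed.

Lemma wfa_legal sigma : all2 (@serves _ _ _) sigma (trajectory A sigma).
Proof.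
case: sigma => // x0 s; rewrite -(mkseq_nth x0 (x0 :: s)).
move: (nth x0 _) (size _) => rq n; rewrite trajectory_mkseq.
elim: n => // n IH; rewrite mkseqS [X in all2 _ _ X]mkseqS all2_rcons IH /=.
by rewrite mkseqS wfa_serves.
Qed.

Lemma wfa_cost sigma : alg_cost w A sigma <=
  2 * (Kc R k d + 2) * (Wlt k w d + K%:R * opt_cost w C0 sigma).
Proof.
have kc0 := Kc_ge0 R k d; have W0 := Wlt_ge0 k w_gt0 d.
case: sigma => [|x0 s].
  rewrite /alg_cost /= mulr_ge0 ?addr_ge0 ?mulr_ge0 ?addr_ge0 ?opt_ge0 //.
rewrite -(mkseq_nth x0 (x0 :: s)); move: (nth x0 _) (size _) => rq n.
have [A0 _] := A_wfa.
pose WF t := wf (mkseq rq t); pose C t := A (mkseq rq t).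
have WF_le t X Y : serves (rq t) X -> WF t.+1 Y <= WF t X + dist X Y.
  by rewrite /WF mkseqS; apply: wf_step_le.
have WF_att t Y : exists2 X, serves (rq t) X & WF t X + dist X Y <= WF t.+1 Y.
  by rewrite /WF mkseqS; apply: wf_step_att.
have WF_lip t X Y : WF t Y <= WF t X + dist X Y by apply: wf_lip.
have alg_min t X : WF t (C t) <= WF t X + 1 / 2 * dist X (C t).
  exact: wfa_min.
have alg_step t : WF t.+1 (C t.+1) + 1 / 2 * dist (C t.+1) (C t) <= WF t.+1 (C t).
  by rewrite /WF /C mkseqS; apply: wfa_step.
have /choice [Y Y_min] : forall t, exists Y, forall X, WF t Y <= WF t X.
  by move=> t; have [Y _ h] := @fin_min R conf predT (WF t) C0 isT; exists Y => X; apply: h.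
have := alg_total w_gt0 k_gt0 w_incr WF_le WF_att WF_lip alg_min Y_min alg_step
  (wf_ge0 (mkseq rq n) (C n)).
have -> : WF 0%N (C 0%N) = 0 by rewrite /WF /C /= A0 wf_nil.
have Y0 := wf_ge0 (mkseq rq 0) (Y 0%N).
have Yn := wf_le_opt (Y_min n).
have -> : alg_cost w A (mkseq rq n) = path_cost (@move_cost R U d k w) (C 0%N)
    (mkseq (fun t => C t.+1) n) by rewrite /alg_cost trajectory_mkseq.
rewrite path_cost_mkseq => h.
apply: (@le_trans _ _ (pc w C 0 n)); first by apply: ler_sum => u _; apply: move_le_dist.
apply: le_trans h _; rewrite add0r -mulrA ler_wpM2l // ler_wpM2l ?addr_ge0 //.
rewrite lerD2l; rewrite /WF in Y0 Yn *; lra.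
Qed.

End Instance.

Theorem theorem3 (R : realType) :
  exists c : R, 0 < c /\
    forall (U : finType) (d : nat) (k : 'I_d -> nat) (w : 'I_d -> R),
      (0 < d)%N ->
      (forall i : 'I_d, (0 < k i)%N) ->
      (forall i : 'I_d, 0 < w i) ->
      (forall i j : 'I_d, (i < j)%N -> w i < w j) ->
      forall (C0 : config U k) (A : online_alg U k),
        is_WFA w (1 / 2) C0 A ->
        competitive w
          (2 `^ (c * d%:R * (\sum_(i < d) k i)%:R ^+ 3
                 * \prod_(i < d) ((k i)%:R + 1)))
          C0 A.
Proof.
exists 115; split=> // U d k w d0 k0 w0 wi C0 A wfaA; split.
  exact: (wfa_legal d0 w0 k0 wfaA).
(* The cost of the last, incomplete phase, which is independent of [sigma]. *)
exists (2 * (Kc R k d + 2) * Wlt k w d) => sigma.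
apply: le_trans (wfa_cost d0 w0 k0 wi wfaA sigma) _.
rewrite mulrDr addrC lerD2r mulrA ler_wpM2r ?(opt_ge0 d0 w0 k0) //.
exact: ratio_le.
Qed.
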